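(* Let $\mathcal{G}$ be the group functor on commutative rings sending $A$ to the group of continuous $A$-algebra automorphisms of $A((t))$. Let $\operatorname{Lie}\hat{B}$ and $\operatorname{Lie}D$ be the Lie algebra $2$-cocycles on the Lie algebra valued functor $\operatorname{Lie}\mathcal{G}$ with coefficients in $\mathbb{G}_a$ that correspond to the formal Bott-Thurston $2$-cocycle $\hat{B}$ and to the $2$-cocycle $D$ of the determinantal central extension. Then there is an equality of $2$-cocycles on $\operatorname{Lie}\mathcal{G}$ with coefficients in $\mathbb{G}_a$: $$12\operatorname{Lie}D=\operatorname{Lie}\hat{B}.$$ (That is, for every commutative ring $A$ and all $s,r\in\operatorname{Lie}\mathcal{G}(A)$, $12\operatorname{Lie}D(s,r)=\operatorname{Lie}\hat{B}(s,r)$ in $A$.)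
   Context: **The group functor $\mathcal{G}$.** $A((t))=A[[t]][t^{-1}]$ has the topology with base of neighbourhoods of zero $t^nA[[t]]$, $n\in\mathbb{Z}$. $\mathcal{G}(A)$ is the group of $A$-algebra automorphisms of $A((t))$ that are homeomorphisms. $\varphi\in\mathcal{G}(A)$ is determined by $\widetilde\varphi=\varphi(t)$ via $\varphi(\sum a_it^i)=\sum a_i\widetilde\varphi^{\,i}$; the possible $\widetilde\varphi$ are exactly the series $\sum_{i\ge -n}a_it^i$ with $a_1\in A^*$ and $a_i$ nilpotent for $i\le0$. Functoriality in $A$ is on coefficients. For $f=\sum b_it^i$, $f\circ\widetilde\varphi=\sum b_i\widetilde\varphi^{\,i}$. **Contou-Carrère symbol.** For $f\in A((t))^*$ there is a unique decomposition $f=\prod_{i<0}(1-a_it^i)\cdot a_0t^{\nu(f)}\prod_{i>0}(1-a_it^i)$ with $\nu(f)$ a locally constant $\mathbb{Z}$-valued function on $\operatorname{Spec}A$, $a_0\in A^*$, $a_i$ nilpotent for $i<0$ and the product over $i<0$ finite (powers with locally constant exponents are defined factor by factor on the corresponding finite product decomposition of $A$). If $g$ has the analogous decomposition with $b_j$, then (with $(i,j)$ the greatest common divisor) $$\mathrm{CC}(f,g)=(-1)^{\nu(f)\nu(g)}\frac{a_0^{\nu(g)}\prod_{i>0}\prod_{j>0}\bigl(1-a_i^{j/(i,j)}b_{-j}^{i/(i,j)}\bigr)^{(i,j)}}{b_0^{\nu(f)}\prod_{i>0}\prod_{j>0}\bigl(1-a_{-i}^{j/(i,j)}b_{j}^{i/(i,j)}\bigr)^{(i,j)}}\in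 A^*.$$ **The group cocycles** (on $\mathcal{G}$ with coefficients in $\mathbb{G}_m$, trivial action). $\hat{B}(\varphi_1,\varphi_2)=\mathrm{CC}(\widetilde{\varphi_1}',\ \widetilde{\varphi_2}'\circ\widetilde{\varphi_1})$, where $'=\partial/\partial t$. $D(f,g)=\det(d_fd_gd_{fg}^{-1})$, where $d_h=\mathrm{pr}\circ h|_{A[[t]]}:A[[t]]\to A[[t]]$ with $\mathrm{pr}$ the projection of $A((t))=t^{-1}A[t^{-1}]\oplus A[[t]]$ onto $A[[t]]$; each $d_h$, $h\in\mathcal{G}(A)$, is bijective, and $d_fd_gd_{fg}^{-1}$ is the identity on some $t^nA[[t]]$, $n\ge0$, so its determinant is that of the induced automorphism of $A[[t]]/t^nA[[t]]$. **Lie algebras and Lie cocycles.** $\operatorname{Lie}\mathcal{G}(A)=\ker(\mathcal{G}(A[\varepsilon]/(\varepsilon^2))\to\mathcal{G}(A))$ is identified with the Lie $A$-algebra of continuous $A$-derivations of $A((t))$ with commutator bracket; $g\frac{\partial}{\partial t}$, $g\in A((t))$, corresponds to the automorphism $t\mapsto t+g\varepsilon$. $\operatorname{Lie}\mathbb{G}_m=\mathbb{G}_a$, $\mathbb{G}_a(A)=A$ with zero bracket. For a $2$-cocycle $\Lambda$ on $\mathcal{G}$ with coefficients in $\mathbb{G}_m$, $\operatorname{Lie}\Lambda$ is the Lie algebra $2$-cocycle of the induced central extension of Lie algebra valued functors with the induced section; explicitly, for $h_1,h_2\in\operatorname{Lie}\mathcal{G}(A)$ viewed via $h_i\in\mathcal{G}(A[\varepsilon_i]/(\varepsilon_i^2))\subset\mathcal{G}(A[\varepsilon_1,\varepsilon_2]/(\varepsilon_1^2,\varepsilon_2^2))$,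 one has $\Lambda(h_1,h_2)\Lambda(h_2,h_1)^{-1}=1+\operatorname{Lie}\Lambda(h_1,h_2)\,\varepsilon_1\varepsilon_2$ in $(A[\varepsilon_1,\varepsilon_2]/(\varepsilon_1^2,\varepsilon_2^2))^*$. *)

(* Defs.v *)
From HB Require Import structures.
From mathcomp Require Import all_boot all_order all_algebra.
From mathcomp Require Import all_classical topology.
From mathcomp Require Import zify.

Set Implicit Arguments.
Unset Strict Implicit.
Unset Printing Implicit Defensive.

Import Order.TTheory GRing.Theory Num.Theory.

Local Open Scope classical_set_scope.
Local Open Scope ring_scope.

(* Commutative rings are [comPzRingType]s, so the zero ring is allowed.
   MathComp's [GRing.inv] needs a nonzero ring, whence the next definition;
   [rinv x] is only used at invertible [x], where the inverse is unique. *)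
Definition is_unit (A : comPzRingType) (x : A) : Prop := exists y, x * y = 1.

Definition rinv (A : comPzRingType) (x : A) : A := xget 0 [set y | x * y = 1].

Definition zpow (A : comPzRingType) (x : A) (n : int) : A :=
  match n with
  | Posz k => x ^+ k
  | Negz k => rinv x ^+ k.+1
  end.

Definition nilpotent (A : comPzRingType) (x : A) : Prop :=
  exists n : nat, x ^+ n = 0.

Record laurent (A : comPzRingType) := Laurent {
  coef :> int -> A;
  coef_bound : exists n : int, forall i, i < n -> coef i = 0 }.

HB.instance Definition _ (A : comPzRingType) := gen_eqMixin (laurent A).
HB.instance Definition _ (A : comPzRingType) := gen_choiceMixin (laurent A).

Lemma laurent_eq (A : comPzRingType) (f g : laurent A) : f =1 g -> f = g.
Proof.
case: f g => [f hf] [g hg] /= /funext fg; rewrite fg in hf *.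
by congr Laurent; apply: Prop_irrelevance.
Qed.

Section LaurentRing.
Variable A : comPzRingType.
Implicit Types f g h : laurent A.

Lemma laurent_bound f : exists a : nat, forall i, i < - a%:Z -> f i = 0.
Proof.
case: (coef_bound f) => n hn; exists `|n|%N => i hi; apply: hn; lia.
Qed.

Fact mono_bound (c : A) (n : int) :
  exists m : int, forall i, i < m -> (if i == n then c else 0) = 0.
Proof. by exists n => i; case: eqP => // ->; rewrite ltxx. Qed.
Definition mono c n : laurent A := Laurent (mono_bound c n).

Fact add_bound f g :
  exists n : int, forall i, i < n -> f i + g i = 0.
Proof.
case: (coef_bound f) (coef_bound g) => a ha [b hb].
by exists (Num.min a b) => i; rewrite lt_min => /andP[/ha -> /hb ->]; rewrite addr0.
Qed.
Definition laurent_add f g : laurent A := Laurent (add_bound f g).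

Fact opp_bound f : exists n : int, forall i, i < n -> - f i = 0.
Proof. by case: (coef_bound f) => n hn; exists n => i /hn ->; rewrite oppr0. Qed.
Definition laurent_opp f : laurent A := Laurent (opp_bound f).

Fact laurent_addA : associative laurent_add.
Proof. by move=> f g h; apply: laurent_eq => i /=; rewrite addrA. Qed.
Fact laurent_addC : commutative laurent_add.
Proof. by move=> f g; apply: laurent_eq => i /=; rewrite addrC. Qed.
Fact laurent_add0 : left_id (mono 0 0) laurent_add.
Proof. by move=> f; apply: laurent_eq => i /=; rewrite if_same add0r. Qed.
Fact laurent_addN : left_inverse (mono 0 0) laurent_opp laurent_add.
Proof. by move=> f; apply: laurent_eq => i /=; rewrite if_same addNr. Qed.

HB.instance Definition _ := GRing.isZmodule.Build (laurent A)
  laurent_addA laurent_addC laurent_add0 laurent_addN.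

Fact scale_bound (c : A) f : exists n : int, forall i, i < n -> c * f i = 0.
Proof. by case: (coef_bound f) => n hn; exists n => i /hn ->; rewrite mulr0. Qed.
Definition laurent_scale c f : laurent A := Laurent (scale_bound c f).

Fact laurent_scaleA a b f :
  laurent_scale a (laurent_scale b f) = laurent_scale (a * b) f.
Proof. by apply: laurent_eq => i /=; rewrite mulrA. Qed.
Fact laurent_scale1 : left_id 1 laurent_scale.
Proof. by move=> f; apply: laurent_eq => i /=; rewrite mul1r. Qed.
Fact laurent_scaleDr : right_distributive laurent_scale +%R.
Proof. by move=> c f g; apply: laurent_eq => i /=; rewrite mulrDr. Qed.
Fact laurent_scaleDl f : {morph laurent_scale^~ f : a b / a + b}.
Proof. by move=> a b; apply: laurent_eq => i /=; rewrite mulrDl. Qed.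

HB.instance Definition _ := GRing.Zmodule_isLmodule.Build A (laurent A)
  laurent_scaleA laurent_scale1 laurent_scaleDr laurent_scaleDl.

Definition conv f g (k : int) : A := \sum_(i \in [set: int]) (f i * g (k - i)).

Lemma convE f g (a b N : nat) (k : int) :
  (forall i : int, i < - a%:Z -> f i = 0) -> (forall i : int, i < - b%:Z -> g i = 0) ->
  k + a%:Z + b%:Z < N%:Z ->
  conv f g k = \sum_(0 <= i < N) f (i%:Z - a%:Z) * g (k - (i%:Z - a%:Z)).
Proof.
move=> hf hg kN; rewrite /conv fsbig_supp.
rewrite (fsbig_fwiden [seq i%:Z - a%:Z | i <- index_iota 0 N]).
- by rewrite big_map.
- have supp (i : int) : f i * g (k - i) != 0 ->
      i \in [seq i%:Z - a%:Z | i <- index_iota 0 N].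
    move=> hi.
    have lei : - a%:Z <= i.
      by rewrite leNgt; apply/negP => /hf fi; rewrite fi mul0r eqxx in hi.
    have leki : - b%:Z <= k - i.
      by rewrite leNgt; apply/negP => /hg gi; rewrite gi mulr0 eqxx in hi.
    apply/mapP; exists (absz (i + a%:Z)); last by lia.
    by rewrite mem_index_iota; lia.
  by move=> i [_ /= /eqP]; apply: supp.
- rewrite map_inj_uniq ?iota_uniq // => x y /addIr [->] //.
- by move=> i /= [_ /not_andP[//|/= /contrapT]].
Qed.

Lemma conv_lt f g (a b : nat) (k : int) :
  (forall i : int, i < - a%:Z -> f i = 0) -> (forall i : int, i < - b%:Z -> g i = 0) ->
  k < - a%:Z - b%:Z -> conv f g k = 0.
Proof.
move=> hf hg hk; rewrite (@convE f g a b 0) ?big_geq //; lia.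
Qed.

Fact mul_bound f g : exists n : int, forall k, k < n -> conv f g k = 0.
Proof.
have [a ha] := laurent_bound f.
have [b hb] := laurent_bound g.
by exists (- a%:Z - b%:Z) => k; apply: conv_lt.
Qed.
Definition laurent_mul f g : laurent A := Laurent (mul_bound f g).

Fact laurent_mulC : commutative laurent_mul.
Proof.
move=> f g; apply: laurent_eq => k /=; rewrite /conv.
have hb : set_bij [set: int] [set: int] (fun i : int => k - i).
  split=> // [i j _ _ /addrI/oppr_inj // | i _].
  by exists (k - i) => //=; rewrite subKr.
rewrite (reindex_fsbig _ _ _ _ hb).
by apply: eq_fsbigr => i _; rewrite subKr mulrC.
Qed.

Fact laurent_mulCA f g h :
  laurent_mul h (laurent_mul f g) = laurent_mul f (laurent_mul h g).
Proof.
have [a ha] := laurent_bound f.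
have [b hb] := laurent_bound g.
have [c hc] := laurent_bound h.
apply: laurent_eq => k /=.
have hfg i : i < - (a + b)%N%:Z -> conv f g i = 0.
  by move=> hi; apply: (conv_lt ha hb); lia.
have hhg i : i < - (c + b)%N%:Z -> conv h g i = 0.
  by move=> hi; apply: (conv_lt hc hb); lia.
pose N := (`|k| + a + b + c).+1.
have kN : k + a%:Z + b%:Z + c%:Z < N%:Z.
  by rewrite /N; lia.
rewrite (convE (N := N) (g := laurent_mul f g) hc hfg); last by lia.
rewrite (convE (N := N) (g := laurent_mul h g) ha hhg); last by lia.
transitivity (\sum_(0 <= i < N) \sum_(0 <= j < N)
    h (i%:Z - c%:Z) * (f (j%:Z - a%:Z) *
      g (k - (i%:Z - c%:Z) - (j%:Z - a%:Z)))).
  apply: eq_bigr => i _; rewrite -big_distrr /=; congr (_ * _).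
  by apply: (@convE f g a b N) => //; lia.
rewrite exchange_big /=; apply: eq_bigr => j _.
under eq_bigr do rewrite mulrCA.
rewrite -big_distrr /=; congr (_ * _); apply/esym.
rewrite (@convE h g c b N) //; last by lia.
by apply: eq_bigr => i _; rewrite [k - _ - _]addrAC.
Qed.

Fact laurent_mulA : associative laurent_mul.
Proof.
move=> f g h; rewrite [RHS]laurent_mulC [RHS]laurent_mulCA.
by rewrite [laurent_mul h g]laurent_mulC.
Qed.

Fact laurent_mul1 : left_id (mono 1 0) laurent_mul.
Proof.
move=> f; apply: laurent_eq => k /=; rewrite /conv.
rewrite fsbig_supp (fsbig_fwiden [:: (0 : int)]) //=.
- by rewrite big_seq1 mul1r subr0.
- by move=> i [_ /=]; rewrite inE; case: eqP => // _ /[!mul0r].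
- by move=> i /= [_ /not_andP[//|/= /contrapT]].
Qed.

Fact laurent_mulDl : left_distributive laurent_mul +%R.
Proof.
move=> f1 f2 g; apply: laurent_eq => k /=.
have [a ha] := laurent_bound f1.
have [b hb] := laurent_bound f2.
have [c hc] := laurent_bound g.
have ha' i : i < - (a + b)%N%:Z -> f1 i = 0 by move=> hi; apply: ha; lia.
have hb' i : i < - (a + b)%N%:Z -> f2 i = 0 by move=> hi; apply: hb; lia.
have hab i : i < - (a + b)%N%:Z -> (f1 + f2) i = 0.
  by move=> hi; rewrite /= ha' ?hb' ?addr0.
pose N := (`|k| + a + b + c).+1.
rewrite (convE (N := N) (f := f1 + f2) hab hc); last by rewrite /N; lia.
rewrite (convE (N := N) ha' hc); last by rewrite /N; lia.
rewrite (convE (N := N) hb' hc); last by rewrite /N; lia.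
by rewrite -big_split /=; apply: eq_bigr => i _; rewrite mulrDl.
Qed.

HB.instance Definition _ := GRing.Zmodule_isComPzRing.Build (laurent A)
  laurent_mulA laurent_mulC laurent_mul1 laurent_mulDl.

End LaurentRing.

(* The fractional ideal t^n A[[t]]. *)
Definition ideal_t (A : comPzRingType) (n : int) : set (laurent A) :=
  [set f | forall i : int, i < n -> f i = 0].
Arguments ideal_t : clear implicits.

Section LaurentTopology.
Variable A : comPzRingType.

Definition laurent_open : set_system (laurent A) :=
  [set U | forall f, U f -> exists n : int, [set f + h | h in ideal_t A n] `<=` U].

Fact laurent_openT : laurent_open setT.
Proof. by move=> f _; exists 0. Qed.

Fact laurent_openI : setI_closed laurent_open.
Proof.
move=> U V hU hV f [/hU [m hm] /hV [n hn]]; exists (Num.max m n).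
move=> _ [h hh <-]; split; [apply: hm|apply: hn]; exists h => // i hi; apply: hh;
  by rewrite lt_max hi ?orbT.
Qed.

Fact laurent_open_bigU (I : Type) (U : I -> set (laurent A)) :
  (forall i, laurent_open (U i)) -> laurent_open (\bigcup_i U i).
Proof.
move=> hU f [i _ /(hU i) [n hn]]; exists n => g /hn Ug; by exists i.
Qed.

HB.instance Definition _ := isOpenTopological.Build (laurent A)
  laurent_openT laurent_openI laurent_open_bigU.
HB.instance Definition _ := isPointed.Build (laurent A) 0.

End LaurentTopology.

Definition var_t (A : comPzRingType) : laurent A := mono 1 1.

Fact deriv_bound (A : comPzRingType) (f : laurent A) :
  exists n : int, forall i, i < n -> f (i + 1) *~ (i + 1) = 0.
Proof.
by have [n hn] := coef_bound f; exists (n - 1) => i hi; rewrite hn ?mul0rz //; lia.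
Qed.
Definition deriv (A : comPzRingType) (f : laurent A) : laurent A :=
  Laurent (deriv_bound f).

Fact map_bound (A B : comPzRingType) (u : {rmorphism A -> B}) (f : laurent A) :
  exists n : int, forall i, i < n -> u (f i) = 0.
Proof. by have [n hn] := coef_bound f; exists n => i /hn ->; rewrite rmorph0. Qed.
Definition map_laurent (A B : comPzRingType) (u : {rmorphism A -> B})
  (f : laurent A) : laurent B := Laurent (map_bound u f).

(* sum_i f_i g^i; the part with i < 0 is a finite sum, the part with i >= 0 is
   a convergent series when g is the image of t under an automorphism. *)
Definition laurent_comp (A : comPzRingType) (f g : laurent A) : laurent A :=
  \sum_(i \in [set i : int | i < 0]) (f i *: zpow g i)
  + limn (fun N => \sum_(i < N) f i%:Z *: g ^+ i).

Definition group_G (A : comPzRingType) : set (laurent A -> laurent A) :=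
  [set phi : laurent A -> laurent A | [/\ linear phi, monoid_morphism phi &
    exists psi : laurent A -> laurent A, [/\ cancel phi psi, cancel psi phi,
                    continuous phi & continuous psi]]].
Arguments group_G : clear implicits.

Definition tilde (A : comPzRingType) (phi : laurent A -> laurent A) :
  laurent A := phi (var_t A).

(* An automorphism of B((t)) is determined by its value at t, through
   f |-> f o (its value at t); here that value is the coefficientwise image of
   [tilde phi]. *)
Definition G_map (A B : comPzRingType) (u : {rmorphism A -> B})
    (phi : laurent A -> laurent A) : laurent B -> laurent B :=
  fun f => laurent_comp f (map_laurent u (tilde phi)).

Section ContouCarrere.
Variable A : comPzRingType.

(* A locally constant function nu : Spec A -> Z is encoded by the idempotents
   e n of A that cut out the open and closed subsets nu^-1(n). *)
Definition loc_const (e : int -> A) : Prop :=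
  [/\ finite_set [set n | e n != 0],
      forall m n, m != n -> e m * e n = 0 &
      \sum_(n \in [set: int]) e n = 1].

(* For x a unit and e encoding nu, [lc_pow x e] is x^nu, and [lc_mul e e']
   encodes the product of the functions encoded by e and e'. *)
Definition lc_pow (x : A) (e : int -> A) : A :=
  \sum_(n \in [set: int]) (e n * zpow x n).

Definition lc_mul (e e' : int -> A) (k : int) : A :=
  \sum_(p \in [set p : int * int | p.1 * p.2 = k]) (e p.1 * e' p.2).

Definition lc_pow_t (e : int -> A) : laurent A :=
  \sum_(n \in [set: int]) mono (e n) n.

(* f = prod_(i < 0) (1 - a_i t^i) * a_0 t^nu * prod_(i > 0) (1 - a_i t^i), with
   nu encoded by e.  The first product is finite, the last one is a limit. *)
Definition CC_decomposition (f : laurent A) (e a : int -> A) : Prop :=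
  [/\ loc_const e, is_unit (a 0),
      (forall i, i < 0 -> nilpotent (a i)),
      finite_set [set i : int | i < 0 /\ a i != 0] &
      f = \big[*%R/1]_(i \in [set i : int | i < 0]) (1 - mono (a i) i)
          * (a 0 *: lc_pow_t e)
          * limn (fun N => \prod_(1 <= i < N) (1 - mono (a i%:Z) i%:Z))].

(* In the two products below only finitely many factors differ from 1. *)
Definition CC_product (a b : nat -> A) : A :=
  \big[*%R/1]_(p \in [set p : nat * nat | (0 < p.1)%N /\ (0 < p.2)%N])
    (1 - a p.1 ^+ (p.2 %/ gcdn p.1 p.2)%N * b p.2 ^+ (p.1 %/ gcdn p.1 p.2)%N)
      ^+ gcdn p.1 p.2.

Definition CC_value (e a e' b : int -> A) : A :=
  lc_pow (- 1) (lc_mul e e')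
  * (lc_pow (a 0) e' * CC_product (fun i => a i%:Z) (fun j => b (- j%:Z)))
  * rinv (lc_pow (b 0) e * CC_product (fun i => a (- i%:Z)) (fun j => b j%:Z)).

(* An invertible Laurent series has a unique decomposition, so this is the
   well-defined symbol for invertible f and g; its value elsewhere is junk. *)
Definition CC (f g : laurent A) : A :=
  xget 1 [set c | exists e a e' b,
    [/\ CC_decomposition f e a, CC_decomposition g e' b &
        c = CC_value e a e' b]].

End ContouCarrere.

Definition cocycle_B (A : comPzRingType) (phi1 phi2 : laurent A -> laurent A) : A :=
  CC (deriv (tilde phi1)) (laurent_comp (deriv (tilde phi2)) (tilde phi1)).

Section DeterminantCocycle.
Variable A : comPzRingType.

(* The power series are the elements of [ideal_t A 0]. *)
Fact proj_bound (f : laurent A) :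
  exists n : int, forall i, i < n -> (if 0 <= i then f i else 0) = 0.
Proof. by exists 0 => i; rewrite ltNge => /negbTE ->. Qed.
Definition proj (f : laurent A) : laurent A := Laurent (proj_bound f).

Definition d_op (h : laurent A -> laurent A) : laurent A -> laurent A :=
  proj \o h.

(* The inverse of the bijection [d_op h] of A[[t]]. *)
Definition d_inv (h : laurent A -> laurent A) : laurent A -> laurent A :=
  'pinv_(fun=> 0) (ideal_t A 0) (d_op h).

Definition det_op (f g : laurent A -> laurent A) : laurent A -> laurent A :=
  d_op f \o d_op g \o d_inv (f \o g).

(* The determinant of the endomorphism of A[[t]]/t^n A[[t]] induced by M, in the
   basis (t^j)_(j < n), where M is the identity on t^n A[[t]]. *)
Definition det_mod (M : laurent A -> laurent A) (n : nat) : A :=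
  \det (\matrix_(i < n, j < n) M (mono 1 (j : nat)%:Z) (i : nat)%:Z).

(* The determinant does not depend on the choice of n. *)
Definition cocycle_D (f g : laurent A -> laurent A) : A :=
  det_mod (det_op f g)
    (xget 0%N [set n : nat | {in ideal_t A n%:Z, det_op f g =1 id}]).

End DeterminantCocycle.

(* Dnum a b is a + b eps in A[eps]/(eps^2). *)
Record dnum (A : comPzRingType) := Dnum { dn_re : A; dn_im : A }.

Section DualNumbers.
Variable A : comPzRingType.
Implicit Types x y z : dnum A.

Definition dn_pair x := (dn_re x, dn_im x).
Fact dn_pairK : cancel dn_pair (fun p => Dnum p.1 p.2).
Proof. by case. Qed.
HB.instance Definition _ := Choice.copy (dnum A) (can_type dn_pairK).

Definition dn_add x y := Dnum (dn_re x + dn_re y) (dn_im x + dn_im y).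
Definition dn_opp x := Dnum (- dn_re x) (- dn_im x).
Definition dn_mul x y :=
  Dnum (dn_re x * dn_re y) (dn_re x * dn_im y + dn_im x * dn_re y).

Fact dn_addA : associative dn_add.
Proof. by move=> x y z; congr Dnum; apply: addrA. Qed.
Fact dn_addC : commutative dn_add.
Proof. by move=> x y; congr Dnum; apply: addrC. Qed.
Fact dn_add0 : left_id (Dnum 0 0) dn_add.
Proof. by case=> a b; congr Dnum; apply: add0r. Qed.
Fact dn_addN : left_inverse (Dnum 0 0) dn_opp dn_add.
Proof. by case=> a b; congr Dnum; apply: addNr. Qed.
HB.instance Definition _ := GRing.isZmodule.Build (dnum A)
  dn_addA dn_addC dn_add0 dn_addN.

Fact dn_mulA : associative dn_mul.
Proof.
move=> x y z; congr Dnum; rewrite /= ?mulrA //.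
by rewrite mulrDr mulrDl !mulrA addrA.
Qed.
Fact dn_mulC : commutative dn_mul.
Proof.
by move=> x y; congr Dnum; rewrite 1?mulrC // addrC; congr (_ + _); apply: mulrC.
Qed.
Fact dn_mul1 : left_id (Dnum 1 0) dn_mul.
Proof. by case=> a b; congr Dnum; rewrite /= ?mul0r ?addr0 mul1r. Qed.
Fact dn_mulDl : left_distributive dn_mul +%R.
Proof.
move=> x y z; congr Dnum; rewrite /= !mulrDl //.
by rewrite addrACA.
Qed.
HB.instance Definition _ := GRing.Zmodule_isComPzRing.Build (dnum A)
  dn_mulA dn_mulC dn_mul1 dn_mulDl.

Definition eps : dnum A := Dnum 0 1.
Definition dn_const (c : A) : dnum A := Dnum c 0.

Fact dn_re_additive : zmod_morphism (@dn_re A). Proof. by []. Qed.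
Fact dn_re_multiplicative : monoid_morphism (@dn_re A). Proof. by []. Qed.
HB.instance Definition _ :=
  GRing.isZmodMorphism.Build (dnum A) A (@dn_re A) dn_re_additive.
HB.instance Definition _ :=
  GRing.isMonoidMorphism.Build (dnum A) A (@dn_re A) dn_re_multiplicative.

Fact dn_const_additive : zmod_morphism dn_const.
Proof. by move=> a b; congr Dnum; rewrite /= subr0. Qed.
Fact dn_const_multiplicative : monoid_morphism dn_const.
Proof. by split=> // a b; congr Dnum; rewrite /= mulr0 mul0r addr0. Qed.
HB.instance Definition _ :=
  GRing.isZmodMorphism.Build A (dnum A) dn_const dn_const_additive.
HB.instance Definition _ :=
  GRing.isMonoidMorphism.Build A (dnum A) dn_const dn_const_multiplicative.

End DualNumbers.

Section DualMap.
Variables (A B : comPzRingType) (u : {rmorphism A -> B}).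

Definition dn_map (x : dnum A) : dnum B := Dnum (u (dn_re x)) (u (dn_im x)).

Fact dn_map_additive : zmod_morphism dn_map.
Proof. by move=> x y; congr Dnum; rewrite /= rmorphB. Qed.
Fact dn_map_multiplicative : monoid_morphism dn_map.
Proof.
split=> [|x y]; congr Dnum; rewrite /= ?rmorph1 ?rmorph0 ?rmorphD ?rmorphM //.
Qed.
HB.instance Definition _ :=
  GRing.isZmodMorphism.Build (dnum A) (dnum B) dn_map dn_map_additive.
HB.instance Definition _ :=
  GRing.isMonoidMorphism.Build (dnum A) (dnum B) dn_map dn_map_multiplicative.

End DualMap.

Definition Lie_G (A : comPzRingType) : set (laurent (dnum A) -> laurent (dnum A)) :=
  [set h | group_G (dnum A) h /\ G_map (@dn_re A) h = id].
Arguments Lie_G : clear implicits.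

(* A[eps1, eps2]/(eps1^2, eps2^2) is dnum (dnum A): the inner eps is eps1 and
   the outer one is eps2. *)
Section LieCocycle.
Variable A : comPzRingType.

Definition eps1 : dnum (dnum A) := dn_const (eps A).
Definition eps2 : dnum (dnum A) := eps (dnum A).

Definition incl1 : {rmorphism dnum A -> dnum (dnum A)} := @dn_const (dnum A).
Definition incl2 : {rmorphism dnum A -> dnum (dnum A)} := dn_map (@dn_const A).

Definition Lie_cocycle
    (Lambda : forall B : comPzRingType,
       (laurent B -> laurent B) -> (laurent B -> laurent B) -> B)
    (h1 h2 : laurent (dnum A) -> laurent (dnum A)) : A :=
  let H1 := G_map incl1 h1 in
  let H2 := G_map incl2 h2 in
  xget 0 [set c : A | Lambda _ H1 H2 * rinv (Lambda _ H2 H1)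
                      = 1 + dn_const (dn_const c) * eps1 * eps2].

Definition Lie_B := Lie_cocycle cocycle_B.
Definition Lie_D := Lie_cocycle cocycle_D.

End LieCocycle.

(* Main.v *)
From mathcomp Require Import all_boot all_order all_fingroup all_algebra.
From mathcomp Require Import all_classical topology zify ring.
Require Import Defs.

Set Implicit Arguments.
Unset Strict Implicit.
Unset Printing Implicit Defensive.

Import Order.TTheory GRing.Theory Num.Theory.

Local Open Scope classical_set_scope.
Local Open Scope ring_scope.

(** Write x d/dt and y d/dt for the derivations given by s and r.  Both sides
    are twice the Gelfand-Fuchs cocycle res (x^(3) y dt).

    An element of Lie G(A) sends t to t + x eps, so it acts by the derivation
    x d/dt.  As eps1 and eps2 have square zero, the two automorphisms over
    A[eps1, eps2] are f |-> f + eps1 x f' and f |-> f + eps2 y f'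
    ([laurent_comp_shift]).  All computations below take place over an arbitrary
    commutative ring with two elements p and q of square zero, in the roles of
    eps1 and eps2, and end in the expression
      S(x, y) = sum_(m > 0) (m^3 - m)/6 x_(m+1) y_(1-m),
    a finite sum whose coefficients are the binomials C(m+1, 3).

    Determinant.  Put X = x d/dt, Y = y d/dt and let P be the projection onto
    A[[t]].  The operators d_f d_g and d_(fg) differ only through the part of
    Y h that P discards and X brings back: d_(fg) - d_f d_g = p q P X (1-P) Y.
    Since p q kills every correction, d_f d_g d_(fg)^-1 = 1 - p q P X (1-P) Y
    ([det_opE]), with determinant 1 - p q tr (P X (1-P) Y).  Going from t^j
    through t^(-l-1) back to t^j contributes
    - j (l+1) x_(j+l+2) y_(-j-l) to the trace; collecting the terms with
    j+l+1 = m turns the coefficients into C(m+1, 3), so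
    D = 1 + p q S(x, y) ([cocycle_D_shift]).

    Symbol.  The series 1 + p x has valuation 0 and coordinates
    a_0 = 1 + p x_0 and a_i = - p x_i.  The symbol is defined from any
    decomposition, so this one has to be shown to be the only one
    ([CC_decomposition_infinitesimal]).  In the formula for the symbol of
    1 + p x and 1 + q y, each factor with i <> j contains a square of p or of q,
    which leaves CC(1 + p x, 1 + q y) = 1 - p q sum_i i x_i y_(-i), i ranging
    over all integers ([CC_infinitesimal]).  For the two derivatives in the
    Bott-Thurston cocycle the summands become
    i (i+1) (1-i) x_(i+1) y_(1-i), whence
    B = 1 + 6 p q (S(x, y) - S(y, x)) ([cocycle_B_shift]).

    Finally the Lie cocycle antisymmetrizes.  From D it produces
    S(x, y) - S(y, x); B is already antisymmetric in this sense and yields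
    twice 6 (S(x, y) - S(y, x)). *)

(** * Laurent series: coefficients, orders and limits *)

Section Basics.
Variable A : comPzRingType.
Implicit Types (f g h : laurent A) (c d : A) (i k m n : int).

Lemma coef_sum (I : Type) (s : seq I) (P : pred I) (F : I -> laurent A) k :
  (\sum_(i <- s | P i) F i) k = \sum_(i <- s | P i) F i k.
Proof.
apply: (big_morph (fun f : laurent A => f k)) => //.
by rewrite /= if_same.
Qed.

Lemma fsbig_only1 (T : choiceType) (R : Type) (idx : R) (op : Monoid.com_law idx)
    (P : set T) (F : T -> R) (x : T) :
  P x -> (forall y, P y -> y <> x -> F y = idx) ->
  \big[op/idx]_(i \in P) F i = F x.
Proof.
move=> Px hF; rewrite -(fsbig_set1 op x F); apply/esym/fsbig_widen.
  by move=> _ ->.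
by move=> y [Py /= yx]; apply: hF.
Qed.

Lemma coef_monoM c n f k : (mono c n * f) k = c * f (k - n).
Proof.
rewrite [LHS]/= /conv (@fsbig_only1 _ _ _ _ _ _ n) //= ?eqxx // => i _ /eqP/negbTE ->.
by rewrite mul0r.
Qed.

Lemma mono0 n : mono 0 n = 0 :> laurent A.
Proof. by apply: laurent_eq => k /=; rewrite !if_same. Qed.

Lemma coef_sum_mono (s : seq int) (F : int -> A) k : uniq s ->
  (\sum_(i <- s) F i *: mono 1 i) k = if k \in s then F k else 0.
Proof.
move=> us; rewrite coef_sum; case: ifP => ks.
  rewrite (bigD1_seq k) //= eqxx mulr1 big1 ?addr0 // => i.
  by rewrite eq_sym => /negbTE ->; rewrite mulr0.
rewrite big1_seq //= => i si.
by case: eqP => [ki|_]; [rewrite ki si in ks|rewrite mulr0].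
Qed.

Lemma scale_mono c f : c *: f = mono c 0 * f.
Proof. by apply: laurent_eq => k; rewrite coef_monoM subr0. Qed.

Lemma scaleAl c f g : c *: (f * g) = (c *: f) * g.
Proof. by rewrite !scale_mono mulrA. Qed.

Lemma scaleAr c f g : c *: (f * g) = f * (c *: g).
Proof. by rewrite mulrC scaleAl mulrC. Qed.

Lemma monoM c d m n : mono c m * mono d n = mono (c * d) (m + n).
Proof.
apply: laurent_eq => k; rewrite coef_monoM /=.
by rewrite subr_eq [n + m]addrC; case: ifP; rewrite ?mulr0.
Qed.

Lemma mul_ideal m n f g :
  ideal_t A m f -> ideal_t A n g -> ideal_t A (m + n) (f * g).
Proof.
move=> hf hg k hk; rewrite [LHS]/= /conv fsbig1 // => i _.
by case: (ltP i m) => [/hf ->|hi]; rewrite ?mul0r // hg ?mulr0 //; lia.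
Qed.

(** In the lowest degree only the two lowest coefficients meet. *)
Lemma coef_mul_lowest m n f g : ideal_t A m f -> ideal_t A n g ->
  (f * g) (m + n) = f m * g n.
Proof.
move=> hf hg; rewrite [LHS]/= /conv (@fsbig_only1 _ _ _ _ _ _ m) //.
  by rewrite [m + n]addrC addrK.
move=> i _ im; case: (ltP i m) => [/hf ->|hi]; rewrite ?mul0r //.
by rewrite hg ?mulr0 //; lia.
Qed.

Lemma idealD n f g : ideal_t A n f -> ideal_t A n g -> ideal_t A n (f + g).
Proof. by move=> hf hg i hi; rewrite /= hf ?hg ?addr0. Qed.

Lemma idealZ n c f : ideal_t A n f -> ideal_t A n (c *: f).
Proof. by move=> hf i hi; rewrite /= hf ?mulr0. Qed.

Lemma ideal_deriv n f : ideal_t A n f -> ideal_t A (n - 1) (deriv f).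
Proof. by move=> hf i hi; rewrite /= hf ?mul0rz //; lia. Qed.

Lemma ideal_le m n f : m <= n -> ideal_t A n f -> ideal_t A m f.
Proof. by move=> mn hf i hi; apply: hf; lia. Qed.

Lemma ideal_open f n : open [set f + h | h in ideal_t A n].
Proof.
move=> _ [h hh <-]; exists n => _ [h' hh' <-]; exists (h + h').
  exact: idealD.
by rewrite addrA.
Qed.

(** Limits are chosen points, so their values can be computed only once limits
    are known to be unique. *)
Lemma laurent_hausdorff : hausdorff_space (laurent A).
Proof.
rewrite open_hausdorff => f g fg.
have [k hk] : exists k, f k <> g k.
  apply: contrapT => H; move/eqP: fg; apply; apply: laurent_eq => k.
  by apply: contrapT => h; apply: H; exists k.
exists ([set f + h | h in ideal_t A (k + 1)], [set g + h | h in ideal_t A (k + 1)]).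
  by split; apply/mem_set; exists 0; rewrite ?addr0 // => i _; rewrite /= if_same.
split; [exact: ideal_open..|].
apply/eqP; rewrite -subset0 => _ [[h hh <-] [h' hh' /(congr1 (fun f => coef f k))]] /=.
by rewrite hh ?hh' ?addr0; [move/esym|lia..].
Qed.

(** The constant c is there for truncated substitutions, which agree with the
    limit only up to a fixed number of degrees below N; truncated products agree
    with it up to degree N. *)
Lemma lim_laurent (u : nat -> laurent A) f (c : int) :
  (forall N : nat, ideal_t A (N%:Z - c) (f - u N)) -> limn u = f.
Proof.
move=> hu; apply: (cvg_lim laurent_hausdorff).
move=> U; rewrite nbhsE => -[V [oV Vf] VU].
have [n hn] := oV _ Vf.
exists (absz (n + c)) => // N /= hN; apply: VU; apply: hn.
exists (u N - f); last by rewrite addrC subrK.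
move=> i hi; have := hu N i; rewrite /= => h.
by apply/eqP; rewrite -[_ + _]opprK oppr_eq0 opprB; apply/eqP/h; lia.
Qed.

Lemma derivD f g : deriv (f + g) = deriv f + deriv g.
Proof. by apply: laurent_eq => k; rewrite /= mulrzDl. Qed.

Lemma derivZ c f : deriv (c *: f) = c *: deriv f.
Proof. by apply: laurent_eq => k; rewrite /= mulrzAr. Qed.

Lemma deriv0 : deriv 0 = 0 :> laurent A.
Proof. by apply: laurent_eq => k /=; rewrite !if_same mul0rz. Qed.

Lemma deriv_mono c n : deriv (mono c n) = mono (c *~ n) (n - 1).
Proof.
apply: laurent_eq => k /=; rewrite -subr_eq0 -[k == _]subr_eq0 opprB addrA.
by case: eqP => [h|_]; rewrite ?mul0rz // ; congr (_ *~ _); lia.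
Qed.

Lemma rinvE (x y : A) : x * y = 1 -> rinv x = y.
Proof.
move=> xy; apply: xget_unique => //= z xz.
by rewrite -[z]mulr1 -xy mulrCA mulrA xz mul1r.
Qed.

End Basics.

(** * Substitution of an infinitesimal deformation of t *)

Section Substitution.
Variables (A : comPzRingType) (p : A) (g : laurent A).
Hypothesis p2 : p * p = 0.

(** The first order Taylor expansion of f(t + p g). *)
Definition infinitesimal_shift (f : laurent A) : laurent A := f + p *: (g * deriv f).
Local Notation Phi := infinitesimal_shift.

Lemma shiftD f1 f2 : Phi (f1 + f2) = Phi f1 + Phi f2.
Proof. by rewrite /Phi derivD mulrDr scalerDr addrACA. Qed.

Lemma shiftZ c f : Phi (c *: f) = c *: Phi f.
Proof. by rewrite /Phi derivZ scalerDr -scaleAr !scalerA mulrC. Qed.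

Lemma shiftB f1 f2 : Phi (f1 - f2) = Phi f1 - Phi f2.
Proof. by rewrite -![- f2]scaleN1r shiftD shiftZ scaleN1r. Qed.

Lemma shift0 : Phi 0 = 0.
Proof. by rewrite -[in LHS](scale0r 0) shiftZ scale0r. Qed.

Lemma shift_sum (I : Type) (s : seq I) (F : I -> laurent A) :
  Phi (\sum_(i <- s) F i) = \sum_(i <- s) Phi (F i).
Proof. exact: (big_morph _ shiftD shift0). Qed.

(** Multiplicativity on the powers of t is the Leibniz rule, the term in p^2
    being zero; it gives all integral powers of t + p g at once. *)
Lemma shift_monoM m n : Phi (mono 1 m) * Phi (mono 1 n) = Phi (mono 1 (m + n)).
Proof.
rewrite /Phi !deriv_mono mulrDr !mulrDl monoM mulr1 -!scaleAl -!scaleAr scalerA.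
rewrite p2 scale0r addr0 -addrA -scalerDr.
rewrite -mulrA monoM mulr1 mulrCA monoM mul1r; congr (_ + _ *: _).
rewrite -mulrDr; congr (_ * _); apply: laurent_eq => k /=.
rewrite -!addrA [-1 + n]addrC !addrA.
by case: ifP; rewrite ?addr0 // -mulrzDr addrC.
Qed.

Lemma shift_ideal n b f : ideal_t A b g -> ideal_t A n f ->
  ideal_t A (n - (1 + `|b|)) (Phi f).
Proof.
move=> hg hf; apply: idealD; first by apply: ideal_le hf; lia.
apply: idealZ; have := mul_ideal hg (ideal_deriv hf).
by apply: ideal_le; lia.
Qed.

Lemma zpow_shift n : zpow (Phi (var_t A)) n = Phi (mono 1 n).
Proof.
have s0 : Phi (mono 1 0) = 1.
  by rewrite /Phi deriv_mono mulr0z mono0 mulr0 scaler0 addr0.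
case: n => n.
  elim: n => [|n IHn]; first by rewrite s0.
  by rewrite /= in IHn *; rewrite exprS IHn shift_monoM; congr (Phi (mono _ _)); lia.
rewrite /= (@rinvE _ _ (Phi (mono 1 (-1)))); last by rewrite shift_monoM subrr s0.
elim: n => [//|n IHn].
by rewrite exprS IHn shift_monoM; congr (Phi (mono _ _)); lia.
Qed.

(** The Taylor expansion holds for each power of t by [zpow_shift], hence for
    every truncation of f by linearity.  It passes to the limit because the
    expansion lowers orders by at most the fixed amount 1 + |b|, where b bounds
    the order of g. *)
Lemma laurent_comp_shift f : laurent_comp f (Phi (var_t A)) = Phi f.
Proof.
have [b hb] := coef_bound g; have [a ha] := laurent_bound f.
pose neg := [seq - (i.+1)%:Z | i <- index_iota 0 a].
pose pos N := [seq i%:Z | i <- index_iota 0 N].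
have uneg : uniq neg by rewrite map_inj_uniq ?iota_uniq // => x y; lia.
have upos N : uniq (pos N) by rewrite map_inj_uniq ?iota_uniq // => x y; lia.
have -> : laurent_comp f (Phi (var_t A)) =
    \sum_(i <- neg) f i *: zpow (Phi (var_t A)) i
    + limn (fun N => \sum_(i < N) f i%:Z *: Phi (var_t A) ^+ i).
  rewrite /laurent_comp; congr (_ + _).
  rewrite (fsbig_seq _ _ uneg); apply/esym/fsbig_widen.
    by move=> i /= /mapP[j _ ->]; lia.
  move=> i /= [i0 ineg]; rewrite ha ?scale0r // ltNge; apply/negP => ai.
  by apply: ineg; apply/mapP; exists (`|i|.-1)%N; rewrite ?mem_index_iota; lia.
pose trunc (s : seq int) := \sum_(i <- s) f i *: mono 1 i.
have shift_trunc s : \sum_(i <- s) f i *: zpow (Phi (var_t A)) i = Phi (trunc s).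
  by rewrite shift_sum; apply: eq_bigr => i _; rewrite shiftZ zpow_shift.
rewrite shift_trunc (@lim_laurent _ _ (Phi (f - trunc neg)) (1 + `|b|)).
  by rewrite -shiftD addrC subrK.
move=> N.
have -> : \sum_(i < N) f i%:Z *: Phi (var_t A) ^+ i = Phi (trunc (pos N)).
  by rewrite -shift_trunc big_map big_mkord.
rewrite -shiftB; apply: (shift_ideal hb).
move=> i iN; rewrite /= !coef_sum_mono //.
case: ifP => [|/mapP ineg].
  case: ifP => [/mapP[j _ ->] /mapP[l _]|_ _]; first by lia.
  by rewrite subrr subr0.
case: ifP => [_|/mapP ipos]; first by rewrite subr0 subrr.
rewrite !subr0; case: (ltP i (- a%:Z)) => [/ha //|ai].
exfalso; case: (ltP i 0) => i0; [apply: ineg|apply: ipos].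
  by exists (`|i|.-1)%N; rewrite ?mem_index_iota; lia.
by exists `|i|%N; rewrite ?mem_index_iota; lia.
Qed.

End Substitution.

(** * The determinant cocycle on infinitesimal automorphisms *)

Arguments infinitesimal_shift {A} p g f : simpl never.

(** In the Leibniz expansion a permutation other than the identity moves two
    indices i and s i, so its product contains two off-diagonal factors and is
    divisible by z^2. *)
Lemma det1D_sqr0 (R : comPzRingType) n (z : R) (M : 'M[R]_n) : z * z = 0 ->
  \det (1%:M + z *: M) = 1 + z * \tr M.
Proof.
move=> z2; rewrite /determinant (bigD1 (1%g : 'S_n)) //= odd_perm1 mul1r.
rewrite [X in _ + X]big1 ?addr0 => [|s s1].
  rewrite (eq_bigr (fun i => 1 + z * M i i)); last first.
    by move=> i _; rewrite !mxE perm1 eqxx.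
  rewrite /mxtrace.
  apply: (big_rec2 (fun a b => a = 1 + z * b)); first by rewrite mulr0 addr0.
  move=> i a b _ ->; rewrite mulrDl mul1r !mulrDr mulr1 mulrACA z2 mul0r addr0.
  by rewrite -addrA [z * b + _]addrC.
have [i si] : exists i, s i != i.
  apply: contrapT => H; move/eqP: s1; apply; apply/permP => i; rewrite perm1.
  by apply/eqP; apply: contrapT => h; apply: H; exists i; apply/negP.
have offdiag j : s j != j -> (1%:M + z *: M) j (s j) = z * M j (s j).
  by move=> sj; rewrite !mxE eq_sym (negbTE sj) add0r.
rewrite (bigD1 i) //= (bigD1 (s i)) /=; last by [].
rewrite !offdiag //; last by rewrite (inj_eq perm_inj).
by rewrite [X in _ * X]mulrA [X in _ * (X * _)]mulrACA z2 !mul0r mulr0.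
Qed.

Section Proj.
Variable A : comPzRingType.
Implicit Types (f g : laurent A) (c : A).

Lemma projD f g : proj (f + g) = proj f + proj g.
Proof. by apply: laurent_eq => k /=; case: ifP; rewrite ?addr0. Qed.

Lemma projZ c f : proj (c *: f) = c *: proj f.
Proof. by apply: laurent_eq => k /=; case: ifP; rewrite ?mulr0. Qed.

Lemma proj0 : proj 0 = 0 :> laurent A.
Proof. by apply: laurent_eq => k /=; rewrite !if_same. Qed.

Lemma proj_id f : ideal_t A 0 f -> proj f = f.
Proof. by move=> hf; apply: laurent_eq => k /=; case: (leP 0 k) => // /hf. Qed.

Lemma proj_ideal f : ideal_t A 0 (proj f).
Proof. by move=> k /= k0; rewrite leNgt k0. Qed.

Lemma projK f : proj (proj f) = proj f.
Proof. exact/proj_id/proj_ideal. Qed.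
End Proj.

Section DeterminantCocycle.
Variable A : comPzRingType.
Implicit Types (x y f : laurent A) (p q : A).

(** The operator P X (1-P) Y, for X = x d/dt, Y = y d/dt and P = [proj]: the
    part of X Y f that leaves A[[t]] after Y and returns with X. *)
Definition crossing x y f : laurent A :=
  proj (x * deriv (y * deriv f - proj (y * deriv f))).

Lemma crossingZ c x y f : crossing x y (c *: f) = c *: crossing x y f.
Proof.
rewrite /crossing derivZ -scaleAr projZ -scalerBr derivZ -scaleAr.
by rewrite projZ.
Qed.

(** Truncating between the two automorphisms loses q (1-P) Y f, on which the
    outer one acts, after truncation, by p P X alone. *)
Lemma d_op_comp p q x y f : ideal_t A 0 f ->
  d_op (infinitesimal_shift p x \o infinitesimal_shift q y) f
  = d_op (infinitesimal_shift p x) (d_op (infinitesimal_shift q y) f)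
    + (p * q) *: crossing x y f.
Proof.
move=> f0; rewrite /d_op /= /crossing; set M := infinitesimal_shift q y f.
set E := y * deriv f - proj (y * deriv f).
have projE : proj E = 0.
  by rewrite /E -scaleN1r projD projZ projK scaleN1r subrr.
have {1}-> : M = proj M + q *: E.
  rewrite /M /infinitesimal_shift projD projZ (proj_id f0) scalerBr.
  by rewrite -addrA [q *: proj _ + _]addrC subrK.
rewrite shiftD projD; congr (_ + _).
rewrite shiftZ projZ /infinitesimal_shift projD projE add0r projZ.
by rewrite scalerA mulrC.
Qed.

Section Square0.
Variables (p q : A) (x y : laurent A).
Hypotheses (p2 : p * p = 0) (q2 : q * q = 0).
Local Notation H1 := (infinitesimal_shift p x).
Local Notation H2 := (infinitesimal_shift q y).

Lemma d_op_surj c z f : c * c = 0 -> ideal_t A 0 f ->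
  exists2 g, ideal_t A 0 g & d_op (infinitesimal_shift c z) g = f.
Proof.
move=> c2 f0; exists (f - c *: proj (z * deriv f)).
  by rewrite -scalerN -scaleN1r; apply: idealD => //; do 2! apply: idealZ; apply: proj_ideal.
set w := proj (z * deriv f).
rewrite /d_op /= shiftB shiftZ /infinitesimal_shift !projD -scaleN1r !projZ projD projZ.
rewrite -/w !scalerDr !scalerA -mulrA c2 mulr0 scale0r addr0 (proj_id f0).
by rewrite {2}/w projK mulN1r scaleNr addrK.
Qed.

(** Modulo p and q the operator d_(fg) is the identity on A[[t]], and p q
    annihilates p and q. *)
Lemma scale_d_op_comp f : ideal_t A 0 f ->
  (p * q) *: d_op (H1 \o H2) f = (p * q) *: f.
Proof.
move=> f0; rewrite -projZ /= /infinitesimal_shift !scalerDr !scalerA.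
rewrite [p * q * p]mulrAC p2 mul0r scale0r addr0 -mulrA q2 mulr0 scale0r addr0.
by rewrite proj_id //; apply: idealZ.
Qed.

Lemma d_op_compD c f g : d_op (H1 \o H2) (f + c *: g)
  = d_op (H1 \o H2) f + c *: d_op (H1 \o H2) g.
Proof.
by rewrite /d_op /= (shiftD q) (shiftZ q) (shiftD p) (shiftZ p) projD projZ.
Qed.

(** The factors d_f and d_g are onto, and d_(fg) differs from d_f d_g by a
    multiple of p q, which one more correction removes.  Surjectivity is what
    makes [d_inv] a right inverse. *)
Lemma d_op_comp_surj f : ideal_t A 0 f ->
  exists2 g, ideal_t A 0 g & d_op (H1 \o H2) g = f.
Proof.
move=> f0; have [g1 g10 g1f] := d_op_surj x p2 f0.
have [g g0 gg1] := d_op_surj y q2 g10.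
have hg : d_op (H1 \o H2) g = f + (p * q) *: crossing x y g.
  by rewrite d_op_comp // gg1 g1f.
pose T := crossing x y g; have T0 : ideal_t A 0 T by exact: proj_ideal.
exists (g - (p * q) *: T).
  by rewrite -scaleNr; apply: idealD => //; apply: idealZ.
by rewrite -scaleNr d_op_compD hg scaleNr scale_d_op_comp // addrK.
Qed.

(** If z is the chosen preimage of f under d_(fg), then d_f d_g z is
    f - p q T z with T the crossing operator, and p q z = p q f. *)
Lemma det_opE f : ideal_t A 0 f ->
  det_op H1 H2 f = f - (p * q) *: crossing x y f.
Proof.
move=> f0; rewrite /det_op /= /d_inv.
have surj : set_surj (ideal_t A 0) (ideal_t A 0) (d_op (H1 \o H2)).
  by move=> g /d_op_comp_surj[h h0 hg]; exists h.
set z := 'pinv_ _ _ _ _.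
have z0 : ideal_t A 0 z.
  by apply: (surjpinv_image_sub surj); exists f.
have hz : d_op (H1 \o H2) z = f.
  by rewrite /z pinvK // in_setE; apply: surj.
have -> : (p * q) *: crossing x y f = (p * q) *: crossing x y z.
  by rewrite -!crossingZ -{1}hz scale_d_op_comp.
by rewrite -[in RHS]hz d_op_comp // addrK.
Qed.
End Square0.
End DeterminantCocycle.

Lemma coef_mul_finite (A : comPzRingType) (f g : laurent A) (s : seq int) (k : int) :
  uniq s -> (forall i, i \notin s -> f i = 0) ->
  (f * g) k = \sum_(i <- s) f i * g (k - i).
Proof.
move=> us fs; rewrite [LHS]/= /conv (fsbig_seq _ _ us).
by apply/esym/fsbig_widen => // i [_ /= /negP is_]; rewrite fs ?mul0r.
Qed.

Lemma sum_subn_muln (m : nat) : (\sum_(j < m) (m - j) * j = 'C(m.+1, 3))%N.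
Proof.
elim: m => [|m IHm]; first by rewrite big_ord0.
rewrite big_ord_recr /= subSnn mul1n binS -IHm.
have -> : (\sum_(j < m) (m.+1 - j) * j = \sum_(j < m) (m - j) * j + \sum_(j < m) j)%N.
  by rewrite -big_split /=; apply: eq_bigr => j _; rewrite subSn ?mulSn 1?addnC // ltnW.
by rewrite -(big_mkord xpredT id) bin2_sum -addnA binS bin1.
Qed.

(** Sums over j + l + 1 = m; on such an antidiagonal the weights (l + 1) j add
    up to C(m + 1, 3). *)
Lemma sum_antidiagonal (A : pzRingType) (N : nat) (F : nat -> A) :
  (forall m, (N <= m)%N -> F m = 0) ->
  \sum_(j < N) \sum_(l < N) F (j + l.+1)%N *+ (l.+1 * j)
  = \sum_(m < N) F m *+ 'C(m.+1, 3).
Proof.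
move=> F0.
have inner (j : 'I_N) :
    \sum_(l < N) F (j + l.+1)%N *+ (l.+1 * j) = \sum_(m < N) F m *+ ((m - j) * j).
  have jN := ltn_ord j.
  rewrite -(big_mkord xpredT (fun l => F (j + l.+1)%N *+ (l.+1 * j))).
  rewrite -(big_mkord xpredT (fun m => F m *+ ((m - j) * j))).
  rewrite (@big_cat_nat _ _ _ (N - j.+1)) ?leq_subr //=.
  rewrite [X in _ + X]big_nat_cond [X in _ + X]big1 ?addr0; last first.
    by move=> l /andP[/andP[hl _] _]; rewrite F0 ?mul0rn //; lia.
  rewrite [RHS](@big_cat_nat _ _ _ j.+1) //= [X in _ = X + _]big_nat_cond.
  rewrite [X in _ = X + _]big1 ?add0r; last first.
    by move=> m /andP[/andP[_ hm] _]; have -> : (m - j = 0)%N by [lia]; rewrite mulr0n.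
  rewrite -{2}[j.+1]add0n big_addn; apply: eq_bigr => l _.
  by congr (F _ *+ (_ * _)%N); lia.
rewrite (eq_bigr _ (fun j _ => inner j)) exchange_big; apply: eq_bigr => m _ /=.
rewrite -sum_subn_muln (big_ord_widen N (fun j => (m - j) * j)%N) 1?ltnW //.
rewrite -sumrMnr [RHS]big_mkcond; apply: eq_bigr => j _ /=.
by case: ltnP => // mj; have -> : (m - j = 0)%N by [lia].
Qed.

Lemma sum_ord_widen (V : nmodType) (m n : nat) (F : nat -> V) :
  (forall j, (m <= j)%N -> F j = 0) -> \sum_(j < m + n) F j = \sum_(j < m) F j.
Proof.
move=> F0; rewrite big_split_ord /= [X in _ + X]big1 ?addr0 // => j _.
by rewrite F0 ?leq_addr.
Qed.

Section DeterminantValue.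
Variable A : comPzRingType.
Implicit Types (x y f : laurent A) (p q : A).

(** Truncation at m < N of the sum of (m^3 - m)/6 x_(m+1) y_(1-m).  All terms
    with m >= N vanish as soon as y has order at least 2 - N.  Six times the
    antisymmetrization of the full sum is the Gelfand-Fuchs cocycle
    res (x^(3) y dt). *)
Definition virasoro_sum (N : nat) x y : A :=
  \sum_(m < N) (x (m.+1)%:Z * y (1 - m%:Z)) *+ 'C(m.+1, 3).

(** The index l stands for the passage through t^(-l-1), one of the finitely
    many negative powers of t that y d/dt reaches from A[[t]]. *)
Lemma coef_crossing N x y (j k : nat) : ideal_t A (2 - N%:Z) y ->
  crossing x y (mono 1 j%:Z) k%:Z
  = - \sum_(l < N) (x (k + l.+2)%N%:Z * y (- (j + l)%N%:Z)) *+ (l.+1 * j).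
Proof.
move=> hy; rewrite /crossing deriv_mono; set E : laurent A := _ - _.
have coefE i : E i = if 0 <= i then 0 else y (i - j%:Z + 1) *+ j.
  rewrite /E mulrC [LHS]/= -[conv _ _ _]/((mono (1 *~ j%:Z) (j%:Z - 1) * y) i) coef_monoM.
  case: ifP => _; rewrite ?subrr // subr0 mulr_natl.
  by congr (coef y _ *+ _); lia.
clearbody E.
have -> : proj (x * deriv E) k%:Z = (deriv E * x) k%:Z by rewrite mulrC.
rewrite (@coef_mul_finite _ _ _ [seq - (l.+2)%:Z | l <- index_iota 0 N]); first last.
- move=> i /mapP iN /=; rewrite coefE; case: (leP 0 (i + 1)) => hi; first by rewrite mul0rz.
  rewrite hy ?mul0rn ?mul0rz // ltNge; apply/negP => h; apply: iN.
  by exists (`|i| - 2)%N; rewrite ?mem_index_iota; lia.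
- by rewrite map_inj_uniq ?iota_uniq // => a b; lia.
rewrite big_map big_mkord -sumrN; apply: eq_bigr => l _.
rewrite /= coefE; case: leP => [|_]; first by lia.
have -> : - l.+2%:Z + 1 - j%:Z + 1 = - (j + l)%N%:Z by lia.
have -> : k%:Z - - l.+2%:Z = (k + l.+2)%N%:Z by lia.
have -> : - l.+2%:Z + 1 = - l.+1%:Z by lia.
by rewrite mulrNz mulNr -pmulrn mulrnAl mulrnAl -mulrnA [y _ * _]mulrC [(j * _)%N]mulnC.
Qed.

Lemma crossing_eq0 N x y : ideal_t A (2 - N%:Z) y ->
  forall j k : nat, (N <= j)%N -> crossing x y (mono 1 j%:Z) k%:Z = 0.
Proof.
move=> hy j k jN; rewrite (coef_crossing _ _ _ hy) big1 ?oppr0 // => l _.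
by rewrite hy ?mulr0 ?mul0rn //; lia.
Qed.

Lemma trace_crossing N x y : ideal_t A (2 - N%:Z) y ->
  \sum_(j < N) crossing x y (mono 1 j%:Z) j%:Z = - virasoro_sum N x y.
Proof.
move=> hy; rewrite /virasoro_sum -(@sum_antidiagonal _ _ (fun m => x (m.+1)%:Z * y (1 - m%:Z))).
  rewrite -sumrN; apply: eq_bigr => j _; rewrite (coef_crossing _ _ _ hy).
  congr (- _); apply: eq_bigr => l _; congr (coef x _ * coef y _ *+ _); lia.
by move=> m mN; rewrite hy ?mulr0 //; lia.
Qed.

(** The determinant is computed on A[[t]]/t^n for a chosen n about which it is
    only known that p q times the crossing operator vanishes on t^n A[[t]].  So
    p q times the partial trace over j < n does not change when the range is
    enlarged to j < n + N, and then shrunk to j < N. *)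
Lemma cocycle_D_shift N p q x y : p * p = 0 -> q * q = 0 -> ideal_t A (2 - N%:Z) y ->
  cocycle_D (infinitesimal_shift p x) (infinitesimal_shift q y)
  = 1 + p * q * virasoro_sum N x y.
Proof.
move=> p2 q2 hy; rewrite /cocycle_D; set P := [set n : nat | _].
have PE n : P n <-> forall f, ideal_t A n%:Z f -> (p * q) *: crossing x y f = 0.
  have n0 f : ideal_t A n%:Z f -> ideal_t A 0 f by apply: ideal_le; lia.
  split=> h f hf.
    have := h f (mem_set hf); rewrite det_opE; [|done..|exact: n0].
    by move/eqP; rewrite -subr_eq0 addrAC subrr add0r oppr_eq0 => /eqP.
  have {}hf : ideal_t A n%:Z f by rewrite in_setE in hf.
  by rewrite det_opE ?h ?subr0 //; apply: n0.
(* y d/dt maps t^(a+1) A[[t]] into A[[t]], where 1 - [proj] vanishes. *)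
have [n Pn] : exists n, P n.
  have [a ha] := laurent_bound y; exists a.+1; apply/PE => f hf.
  rewrite /crossing; set E : laurent A := _ - _.
  have -> : E = 0.
    apply: laurent_eq => i; rewrite /E [LHS]/= [RHS]/= if_same; case: (leP 0 i) => [_|i0].
      by rewrite subrr.
    rewrite subr0; apply: (@mul_ideal _ (- a%:Z) a%:Z) => //.
      by apply: ideal_le (ideal_deriv hf); lia.
    by rewrite addNr.
  by rewrite deriv0 mulr0 proj0 scaler0.
have {n Pn} := @xgetPex _ 0%N P (ex_intro _ n Pn); set n := xget _ _ => /PE Pn.
pose T i j := crossing x y (mono 1 j%:Z) i%:Z.
have -> : det_mod (det_op (infinitesimal_shift p x) (infinitesimal_shift q y)) n
    = 1 - p * q * \sum_(j < n) T j j.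
  rewrite -mulNr -[X in _ * X]/(\sum_(j < n) (fun j => T j j) j).
  have -> : \sum_(j < n) T j j = \tr (\matrix_(i < n, j < n) T i j).
    by apply: eq_bigr => j _; rewrite mxE.
  rewrite -det1D_sqr0; last by rewrite mulrNN mulrACA p2 mul0r.
  congr (\det _); apply/matrixP => i j; rewrite !mxE det_opE //=.
    by rewrite mulNr eqz_nat -val_eqE /=; case: eqP.
  by move=> k k0 /=; case: eqP => // ?; lia.
rewrite -[virasoro_sum N x y]opprK -(trace_crossing x hy) mulrN; congr (1 - _).
rewrite !mulr_sumr -(@sum_ord_widen _ n N (fun j => p * q * T j j)).
  rewrite [(n + N)%N]addnC (@sum_ord_widen _ N n (fun j => p * q * T j j)) // => j Nj.
  by rewrite /T (crossing_eq0 _ hy) ?mulr0.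
move=> j nj; have := Pn (mono 1 j%:Z); rewrite /T => /(_ _)/(congr1 (fun f => coef f j%:Z)) /= ->.
  by rewrite if_same.
by move=> k kn /=; case: eqP => // ?; lia.
Qed.
End DeterminantValue.

(** * Nilpotent elements and products of factors 1 - a_i t^i *)

Section Nilpotent.
Variable A : comPzRingType.
Implicit Types u v : A.

Lemma nilpotentMl u v : nilpotent u -> nilpotent (u * v).
Proof. by case=> n un; exists n; rewrite exprMn un mul0r. Qed.

Lemma nilpotentB u v : nilpotent u -> nilpotent v -> nilpotent (u - v).
Proof.
case=> m um [n vn]; exists (m + n)%N; rewrite exprDn big1 // => i _.
rewrite exprNn; case: (leqP n i) => ni.
  have -> : v ^+ i = 0 by rewrite -(subnK ni) exprD vn mulr0.
  by rewrite !mulr0 mul0rn.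
have -> : (m + n - i = m + (n - i))%N by lia.
by rewrite exprD um !mul0r mul0rn.
Qed.

Lemma sqr0_nilpotent u : u * u = 0 -> nilpotent u.
Proof. by exists 2; rewrite expr2. Qed.

Lemma idempotent_nilpotent u : u * u = u -> nilpotent u -> u = 0.
Proof.
move=> uu [n un]; have {un} : u ^+ n.+1 = 0 by rewrite exprS un mulr0.
by elim: n => [//|n IHn]; rewrite exprS exprS mulrA uu -exprS.
Qed.
End Nilpotent.

Section EulerProduct.
Variable A : comPzRingType.
Implicit Types (a b : nat -> A) (s : int) (k : int) (N : nat).

(** The sign s = 1 or s = -1 treats the factors of positive and of negative
    degree of a decomposition together. *)
Definition euler a s N : laurent A := \prod_(1 <= i < N) (1 - mono (a i) (s * i%:Z)).

Lemma coef_one k : (1 : laurent A) k = if k == 0 then 1 else 0.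
Proof. by []. Qed.

Lemma coef_sub (f g : laurent A) k : (f - g) k = f k - g k.
Proof. by []. Qed.

Lemma coef_eulerS a s N k : (0 < N)%N ->
  euler a s N.+1 (s * k) = euler a s N (s * k) - a N * euler a s N (s * (k - N%:Z)).
Proof.
move=> N0; have -> : euler a s N.+1 = euler a s N * (1 - mono (a N) (s * N%:Z)).
  by rewrite /euler big_nat_recr.
by rewrite mulrBr mulr1 coef_sub [euler a s N * _]mulrC coef_monoM mulrBr.
Qed.

Section Sign.
Variable s : int.
Hypothesis s2 : s * s = 1.

Lemma sign_eq0 k : (s * k == 0) = (k == 0).
Proof. lia. Qed.

Lemma sign_inj (k l : int) : (s * k == s * l) = (k == l).
Proof. by rewrite -subr_eq0 -mulrBr sign_eq0 subr_eq0. Qed.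

Lemma euler_init a N : (N <= 1)%N -> euler a s N = 1.
Proof. by move=> N1; rewrite /euler big_geq. Qed.

Lemma coef_euler_lt0 a N k : k < 0 -> euler a s N (s * k) = 0.
Proof.
elim: N k => [|N IHN] k k0.
  by rewrite euler_init // coef_one sign_eq0; case: eqP k0 => // ->.
case: (posnP N) => [->|N0].
  by rewrite euler_init // coef_one sign_eq0; case: eqP k0 => // ->.
by rewrite coef_eulerS // !IHN ?mulr0 ?subr0 //; lia.
Qed.

Lemma coef_euler0 a N : euler a s N 0 = 1.
Proof.
elim: N => [|N IHN]; first by rewrite euler_init.
case: (posnP N) => [->|N0]; first by rewrite euler_init.
rewrite -(mulr0 s) coef_eulerS // mulr0 IHN coef_euler_lt0 ?mulr0 ?subr0 //.
by rewrite sub0r oppr_lt0.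
Qed.

(** A factor of index at least N alters only coefficients of index at least N,
    so each coefficient of the infinite product is reached at a finite stage. *)
Lemma coef_euler_stable a N (k : nat) : (k < N)%N ->
  euler a s N (s * k%:Z) = euler a s k.+1 (s * k%:Z).
Proof.
elim: N => [//|N IHN]; rewrite ltnS leq_eqVlt => /orP[/eqP -> //|kN].
rewrite coef_eulerS; last by lia.
by rewrite (@coef_euler_lt0 _ _ (k%:Z - N%:Z)) ?mulr0 ?subr0 ?IHN //; lia.
Qed.

(** The coordinates are recovered one by one: the coefficient of index k is
    - a_k plus an expression in the previous coordinates. *)
Lemma euler_inj a b : (forall k : nat, (0 < k)%N ->
    euler a s k.+1 (s * k%:Z) = euler b s k.+1 (s * k%:Z)) ->
  forall k : nat, (0 < k)%N -> a k = b k.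
Proof.
move=> ab; elim/ltn_ind => k IHk k0; have := ab k k0.
rewrite !coef_eulerS // subrr mulr0 !coef_euler0 !mulr1.
have -> : euler a s k = euler b s k; last by move/addrI/oppr_inj.
by apply: eq_big_nat => i /andP[i0 ik]; rewrite IHk.
Qed.

Lemma coef_euler_nilpotent a N k : (forall i, (0 < i)%N -> nilpotent (a i)) ->
  k != 0 -> nilpotent (euler a s N (s * k)).
Proof.
have nil0 : nilpotent (0 : A) by exists 1%N; rewrite expr1.
move=> ha k0; elim: N => [|N IHN].
  by rewrite euler_init // coef_one sign_eq0 (negbTE k0).
case: (posnP N) => [->|N0].
  by rewrite euler_init // coef_one sign_eq0 (negbTE k0).
by rewrite coef_eulerS //; apply: nilpotentB => //; apply/nilpotentMl/ha.
Qed.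

Lemma euler_infinitesimal p (y : nat -> A) N : p * p = 0 ->
  euler (fun i => - (p * y i)) s N
  = 1 + p *: \sum_(1 <= i < N) mono (y i) (s * i%:Z).
Proof.
move=> p2; rewrite /euler.
apply: (big_rec2 (fun f g : laurent A => f = 1 + p *: g)).
  by rewrite scaler0 addr0.
move=> i g f _ ->.
have -> : 1 - mono (- (p * y i)) (s * i%:Z) = 1 + p *: mono (y i) (s * i%:Z).
  apply: laurent_eq => k /=; congr (_ + _).
  by case: ifP; rewrite ?opprK ?oppr0 ?mulr0.
rewrite mulrDr mulr1 mulrDl mul1r -!scaleAl -!scaleAr scalerA p2 scale0r addr0.
by rewrite scalerDr -addrA.
Qed.

Lemma coef_euler_infinitesimal p (y : nat -> A) N (k : nat) : p * p = 0 ->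
  (0 < k)%N -> euler (fun i => - (p * y i)) s N (s * k%:Z) = if (k < N)%N then p * y k else 0.
Proof.
move=> p2 k0; rewrite euler_infinitesimal //= coef_sum sign_eq0.
have -> : (k%:Z == 0) = false by lia.
rewrite add0r; case: ltnP => kN.
  rewrite (bigD1_seq k) ?mem_index_iota ?iota_uniq ?k0 //= eqxx big1 ?addr0 // => i ik.
  by rewrite sign_inj; case: eqP => // ?; lia.
rewrite big_nat_cond big1 ?mulr0 // => i /andP[/andP[i0 iN] _] /=.
by rewrite sign_inj; case: eqP => // ?; lia.
Qed.
End Sign.

Fact euler_series_bound a :
  exists n : int, forall k, k < n -> (if 0 <= k then euler a 1 `|k|.+1 k else 0) = 0.
Proof. by exists 0 => k; rewrite ltNge => /negbTE ->. Qed.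
Definition euler_series a : laurent A := Laurent (euler_series_bound a).

Lemma lim_euler a : limn (euler a 1) = euler_series a.
Proof.
apply: (@lim_laurent _ _ _ 0) => N k; rewrite subr0 => kN /=.
have ek M : euler a 1 M k = euler a 1 M (1 * k) by rewrite mul1r.
case: leP => k0; last by rewrite ek coef_euler_lt0 // subrr.
case: k kN k0 ek => // k kN _ ek; rewrite !ek.
by rewrite (@coef_euler_stable 1 (mulr1 1) a N k) ?subrr.
Qed.
End EulerProduct.

(** * Decomposition of an infinitesimal deformation of 1 *)

Section Decomposition.
Variable A : comPzRingType.
Implicit Types (x y f g : laurent A) (e a : int -> A) (p : A).

Lemma support_seq e : finite_set [set n | e n != 0] ->
  exists2 s : seq int, uniq s & forall n, (n \in s) = (e n != 0).
Proof.
move=> /finite_seqP[s hs]; exists (undup s); first exact: undup_uniq.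
move=> n; rewrite mem_undup.
have := congr1 (fun B : set int => B n) hs; rewrite /= => h.
by apply/idP/idP; rewrite h.
Qed.

Lemma coef_lc_pow_t e k : finite_set [set n | e n != 0] -> lc_pow_t e k = e k.
Proof.
move=> /support_seq[s us hs].
have -> : lc_pow_t e = \sum_(n <- s) e n *: mono 1 n.
  rewrite /lc_pow_t; under [RHS]eq_bigr do rewrite scale_mono monoM mulr1 add0r.
  rewrite (fsbig_seq _ _ us); apply/esym/fsbig_widen => // n [_ /= /negP].
  by rewrite hs negbK => /eqP ->; rewrite mono0.
by rewrite coef_sum_mono // hs; case: eqP.
Qed.

(** Orthogonal elements of sum 1 are idempotent. *)
Lemma loc_const_mul e m n : loc_const e -> e m * e n = if m == n then e m else 0.
Proof.
case=> /support_seq[s us hs] orth sum1; case: eqP => [<-|/eqP]; last exact: orth.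
case: (eqVneq (e m) 0) => [->|em]; first by rewrite mulr0.
have sum1s : \sum_(k <- s) e k = 1.
  rewrite -sum1 (fsbig_seq _ _ us); apply/fsbig_widen => // k [_ /= /negP].
  by rewrite hs negbK => /eqP ->.
rewrite -[RHS]mulr1 -sum1s big_distrr /= (bigD1_seq m) ?hs //= big1 ?addr0 //.
by move=> k km; rewrite orth // eq_sym.
Qed.

Lemma negative_product a : finite_set [set i : int | i < 0 /\ a i != 0] ->
  exists N, forall M, (N <= M)%N ->
    \big[*%R/1]_(i \in [set i : int | i < 0]) (1 - mono (a i) i)
    = euler (fun i => a (- i%:Z)) (-1) M.
Proof.
move=> /finite_seqP[s hs]; exists (\max_(i <- s) `|i|%N).+1 => M NM.
have aM i : i < 0 -> (M <= `|i|)%N -> a i = 0.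
  move=> i0 iM; apply: contrapT => /eqP ai.
  have : [set` s] i by rewrite -hs.
  move=> /= si; have : (`|i| <= \max_(j <- s) `|j|)%N by apply: leq_bigmax_seq.
  by lia.
pose r := [seq - i%:Z | i <- index_iota 1 M].
have ur : uniq r by rewrite map_inj_uniq ?iota_uniq // => u v; lia.
transitivity (\prod_(i <- r) (1 - mono (a i) i)).
  rewrite (fsbig_seq _ _ ur); apply/esym/fsbig_widen.
    by move=> i /= /mapP[j]; rewrite mem_index_iota => j1 ->; lia.
  move=> i /= [i0 ir]; rewrite aM ?mono0 ?subr0 // leqNgt; apply/negP => iM.
  by apply: ir; apply/mapP; exists `|i|%N; rewrite ?mem_index_iota; lia.
by rewrite big_map; apply: eq_bigr => i _; rewrite mulN1r.
Qed.

Lemma positive_product a :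
  limn (fun N => \prod_(1 <= i < N) (1 - mono (a i%:Z) i%:Z))
  = euler_series (fun i => a i%:Z).
Proof.
rewrite -lim_euler; congr (limn _); apply/funext => N.
by apply: eq_bigr => i _; rewrite mul1r.
Qed.

Lemma eq_euler (b c : nat -> A) s N :
  (forall i, (0 < i)%N -> b i = c i) -> euler b s N = euler c s N.
Proof. by move=> bc; apply: eq_big_nat => i /andP[i0 _]; rewrite bc. Qed.

Lemma eq_euler_series (b c : nat -> A) :
  (forall i, (0 < i)%N -> b i = c i) -> euler_series b = euler_series c.
Proof.
by move=> bc; apply: laurent_eq => k /=; case: ifP => // _; rewrite (eq_euler _ _ bc).
Qed.

Definition neg_part x : laurent A := x - proj x.
Definition pos_part x : laurent A := proj x - mono (x 0) 0.

Lemma partsE x : x = neg_part x + mono (x 0) 0 + pos_part x.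
Proof. by rewrite /neg_part /pos_part addrACA subrr addr0 subrK. Qed.

Lemma coef_neg_part x k : neg_part x k = if k < 0 then x k else 0.
Proof. by rewrite /= ltNge; case: (0 <= k); rewrite ?subrr ?subr0. Qed.

Lemma coef_pos_part x k : pos_part x k = if 0 < k then x k else 0.
Proof.
rewrite /=; case: (ltgtP k 0) => [||->]; by rewrite ?subrr ?subr0.
Qed.

Section Infinitesimal.
Variable p : A.
Hypothesis p2 : p * p = 0.

(** Since p^2 = 0, multiplication of series 1 + p x is addition of the x; in
    particular the inverse of 1 + p x is 1 - p x. *)
Lemma infinitesimalM x y : (1 + p *: x) * (1 + p *: y) = 1 + p *: (x + y).
Proof.
rewrite mulrDr mulr1 mulrDl mul1r -scaleAl -scaleAr scalerA p2 scale0r addr0.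
by rewrite scalerDr addrA.
Qed.

Let s2 : (-1) * (-1) = 1 :> int.
Proof. by []. Qed.

Lemma coef_infinitesimal x k : (1 + p *: x) k = (if k == 0 then 1 else 0) + p * x k.
Proof. by []. Qed.

Lemma euler_neg x M : (forall i : int, i <= - M%:Z -> x i = 0) ->
  euler (fun i => - (p * x (- i%:Z))) (-1) M = 1 + p *: neg_part x.
Proof.
move=> xM; apply: laurent_eq => k; rewrite coef_infinitesimal coef_neg_part.
case: (ltgtP k 0) => [k0|k0|->].
- have {1}-> : k = (-1) * `|k|%N%:Z by lia.
  rewrite coef_euler_infinitesimal //; last by lia.
  rewrite add0r; have -> : - `|k|%N%:Z = k by lia.
  by case: ltnP => // Mk; rewrite xM ?mulr0 //; lia.
- have -> : k = (-1) * (- k) by lia.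
  by rewrite coef_euler_lt0 ?mulr0 ?addr0 //; lia.
by rewrite coef_euler0 // mulr0 addr0.
Qed.

Lemma euler_pos x :
  euler_series (fun i => - (p * x i%:Z)) = 1 + p *: pos_part x.
Proof.
apply: laurent_eq => k; rewrite coef_infinitesimal coef_pos_part /=.
case: (ltgtP k 0) => [k0|k0|->]; first by rewrite mulr0 addr0.
  have {2 3}-> : k = 1 * `|k|%N%:Z by lia.
  by rewrite coef_euler_infinitesimal ?ltnSn ?add0r ?mul1r //; lia.
by rewrite coef_euler0 ?mulr0 ?addr0.
Qed.

Definition trivial_val (n : int) : A := if n == 0 then 1 else 0.
Definition infinitesimal_coord x (n : int) : A :=
  if n == 0 then 1 + p * x 0 else - (p * x n).

Lemma is_unit_infinitesimal u : is_unit (1 + p * u).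
Proof. by exists (1 - p * u); ring: p2. Qed.

Lemma trivial_val_loc_const : loc_const trivial_val.
Proof.
split.
- apply: (@sub_finite_set _ _ [set (0 : int)]); last exact: finite_set1.
  by move=> n; rewrite /= /trivial_val; case: (eqVneq n 0) => // _; rewrite eqxx.
- move=> m n mn; rewrite /trivial_val; case: (eqVneq m 0) => [m0|_]; rewrite ?mul0r //.
  by case: (eqVneq n 0) => [n0|_]; rewrite ?mulr0 //; move: mn; rewrite m0 n0 eqxx.
rewrite (@fsbig_only1 _ _ _ _ _ _ 0) ?/trivial_val ?eqxx //.
by move=> n _ /eqP/negbTE ->.
Qed.

Lemma infinitesimal_decomposition x :
  CC_decomposition (1 + p *: x) trivial_val (infinitesimal_coord x).
Proof.
have coordE n : n != 0 -> infinitesimal_coord x n = - (p * x n).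
  by rewrite /infinitesimal_coord => /negbTE ->.
have fin : finite_set [set i : int | i < 0 /\ infinitesimal_coord x i != 0].
  have [b hb] := laurent_bound x.
  pose r := [seq - i%:Z | i <- index_iota 0 b.+1].
  apply: (@sub_finite_set _ _ [set` r]) => // i /= [i0].
  rewrite coordE ?lt_eqF // => xi; apply/mapP; exists `|i|%N; last by lia.
  rewrite mem_index_iota ltnS leqNgt; apply/negP => ib.
  by move: xi; rewrite hb ?mulr0 ?oppr0 ?eqxx //; lia.
split.
- exact: trivial_val_loc_const.
- rewrite /infinitesimal_coord eqxx; exact: is_unit_infinitesimal.
- move=> i i0; rewrite coordE ?lt_eqF //; apply: sqr0_nilpotent.
  by rewrite mulrNN mulrACA p2 mul0r.
- exact: fin.
have [N hN] := negative_product fin.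
have [b hb] := laurent_bound x.
rewrite (hN (maxn N b.+1)) ?leq_maxl //.
have -> : lc_pow_t trivial_val = 1.
  apply: laurent_eq => k; rewrite coef_lc_pow_t //.
  by case: trivial_val_loc_const.
have -> : infinitesimal_coord x 0 *: (1 : laurent A) = 1 + p *: mono (x 0) 0.
  rewrite /infinitesimal_coord eqxx scalerDl scale1r; congr (_ + _).
  by apply: laurent_eq => k /=; case: ifP; rewrite ?mulr1 ?mulr0.
rewrite positive_product.
rewrite (@eq_euler _ (fun i => - (p * x (- i%:Z)))); last first.
  by move=> i i0; rewrite coordE //; lia.
rewrite (@eq_euler_series _ (fun i => - (p * x i%:Z))); last first.
  by move=> i i0; rewrite coordE //; lia.
rewrite euler_neg; last first.
  by move=> i iN; apply: hb; have := leq_maxr N b.+1; lia.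
by rewrite euler_pos !infinitesimalM -partsE.
Qed.

(** A power series with constant term 1 neither raises nor lowers the order of
    the other factor, nor does it change the lowest coefficient.  This takes the
    place of inverting g. *)
Lemma mul_power_series_lowest n m f g : ideal_t A n f -> ideal_t A 0 g -> g 0 = 1 ->
  ideal_t A m (f * g) -> ideal_t A m f /\ f m = (f * g) m.
Proof.
move=> fn g0 g01 fgm.
have step k : ideal_t A k f -> f k = (f * g) k.
  by move=> fk; have := coef_mul_lowest fk g0; rewrite addr0 g01 mulr1.
have low (j : nat) : n + j%:Z <= m -> ideal_t A (n + j%:Z) f.
  elim: j => [|j IHj] jm; first by rewrite addr0.
  have fj := IHj (ltac:(lia)).
  move=> k kj; case: (ltP k (n + j%:Z)) => [/fj //|jk].
  by have -> : k = n + j%:Z; [lia|rewrite step // fgm //; lia].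
have fm : ideal_t A m f.
  case: (leP n m) => nm; last by apply: ideal_le fn; apply: ltW.
  have := low `|m - n|%N; have -> : n + `|m - n|%N%:Z = m by lia.
  exact.
by split; rewrite ?step.
Qed.

Lemma mul_nonpositive f g : (forall k, 0 < k -> f k = 0) ->
  (forall k, 0 < k -> g k = 0) -> forall k, 0 <= k ->
  (f * g) k = if k == 0 then f 0 * g 0 else 0.
Proof.
move=> f0 g0 k k0; rewrite [LHS]/= /conv (@fsbig_only1 _ _ _ _ _ _ 0) // ?subr0.
  case: eqP => [->//|kn]; rewrite g0 ?mulr0 //; lia.
move=> i _ i0; case: (ltP 0 i) => hi; first by rewrite f0 ?mul0r.
by rewrite g0 ?mulr0 //; lia.
Qed.

(** Let F- a_0 t^nu F+ be a decomposition of 1 + p x.  Multiply F- and F+ by the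
    inverses of the two factors expected of 1 + p x, which are known explicitly.
    The outcome is W a_0 t^nu V = 1 + p x_0, where W is 1 plus terms of negative
    degree with nilpotent coefficients and V is a power series with constant
    term 1.  On the part of the spectrum where nu = n, cut out by the idempotent
    e_n, [mul_power_series_lowest] compares a_0 t^n W with the constant on the
    right.  If n < 0, the former has e_n a_0 in degree n, so e_n = 0.  If n > 0,
    then e_n (1 + p x_0) is a multiple of the coefficient of W in degree -n, so
    e_n is nilpotent, again 0.  Hence nu = 0, W has no term of negative degree,
    and W = V = 1.  This determines F- and F+, and the coordinates follow by
    [euler_inj]. *)
Lemma CC_decomposition_infinitesimal x e a : CC_decomposition (1 + p *: x) e a ->
  e = trivial_val /\ a = infinitesimal_coord x.
Proof.
case=> he [c0 ca] anil afin; rewrite positive_product.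
have [M hM] := negative_product afin; rewrite (hM _ (leqnn M)).
set Fm := euler _ _ _; set Fp := euler_series _; move=> hf.
pose xm := neg_part x; pose xp := pos_part x.
pose W := (1 + p *: - xm) * Fm; pose V := Fp * (1 + p *: - xp).
have WTV : W * (a 0 *: lc_pow_t e) * V = 1 + p *: mono (x 0) 0.
  transitivity ((1 + p *: - xm) * (1 + p *: x) * (1 + p *: - xp)).
    by rewrite hf /W /V; ring.
  rewrite !infinitesimalM; congr (_ + _ *: _).
  by rewrite {1}(partsE x) -/xm -/xp; ring.
have coefW k : W k = Fm k - p * (xm * Fm) k.
  by rewrite /W mulrDl mul1r -scaleAl mulNr [LHS]/= mulrN.
have Fm_gt0 k : 0 < k -> Fm k = 0.
  move=> k0; have -> : k = (-1) * (- k) by lia.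
  by apply: coef_euler_lt0 => //; lia.
have Fm0 : Fm 0 = 1 by exact: coef_euler0.
have Fm_nil k : k != 0 -> nilpotent (Fm k).
  move=> k0; have -> : k = (-1) * (- k) by lia.
  by apply: coef_euler_nilpotent => //; [move=> i i0; apply: anil; lia|lia].
have xm_ge0 k : 0 <= k -> xm k = 0.
  by rewrite /xm coef_neg_part ltNge => ->.
have xmFm k : 0 <= k -> (xm * Fm) k = 0.
  move=> k0; rewrite mul_nonpositive ?xm_ge0 ?mul0r ?if_same // => j j0.
  by rewrite xm_ge0 // ltW.
have W_gt0 k : 0 < k -> W k = 0.
  by move=> k0; rewrite coefW Fm_gt0 // xmFm ?mulr0 ?subr0 // ltW.
have W0 : W 0 = 1 by rewrite coefW Fm0 xmFm // mulr0 subr0.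
have W_nil k : k != 0 -> nilpotent (W k).
  move=> k0; rewrite coefW; apply: nilpotentB; first exact: Fm_nil.
  exact/nilpotentMl/sqr0_nilpotent.
have Fp_ideal : ideal_t A 0 Fp by move=> k k0; rewrite /= leNgt k0.
have Fp0 : Fp 0 = 1 by exact: coef_euler0.
have xp_le0 k : k <= 0 -> xp k = 0.
  by move=> k0; rewrite /xp coef_pos_part ltNge k0.
have Vr_ideal : ideal_t A 0 (1 + p *: - xp).
  move=> k k0; rewrite coef_infinitesimal lt_eqF // add0r.
  by rewrite -[(- xp) k]/(- xp k) xp_le0 ?oppr0 ?mulr0 // ltW.
have V_ideal : ideal_t A 0 V by rewrite -[0]addr0; apply: mul_ideal.
have V0 : V 0 = 1.
  have := coef_mul_lowest Fp_ideal Vr_ideal; rewrite addr0 => ->.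
  rewrite Fp0 mul1r coef_infinitesimal eqxx -[(- xp) 0]/(- xp 0) xp_le0 //.
  by rewrite oppr0 mulr0 addr0.
have [b hb] := laurent_bound W.
have fin : finite_set [set n | e n != 0] by case: he.
have [d cd] := is_unit_infinitesimal (x 0).
(* The part of the identity [WTV] on which the valuation is n. *)
have component n : ideal_t A 0 (mono (a 0 * e n) n * W) /\
    a 0 * e n * W (- n) = e n * (1 + p * x 0).
  have Z : mono (a 0 * e n) n * W * V = e n *: (1 + p *: mono (x 0) 0).
    rewrite -WTV.
    have eT : e n *: lc_pow_t e = mono (e n) n.
      apply: laurent_eq => k; rewrite /= coef_lc_pow_t // loc_const_mul // eq_sym.
      by case: eqP => // ->.
    have -> : mono (a 0 * e n) n = e n *: (a 0 *: lc_pow_t e).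
      by rewrite scalerA [e n * a 0]mulrC -scalerA eT scale_mono monoM add0r.
    by rewrite [W * _]mulrC -!scaleAl.
  have monoW : ideal_t A (n - b%:Z) (mono (a 0 * e n) n * W).
    by move=> k kn; rewrite coef_monoM hb ?mulr0 //; lia.
  have Z0 : ideal_t A 0 (mono (a 0 * e n) n * W * V).
    rewrite Z; apply: idealZ => k k0; rewrite coef_infinitesimal /= lt_eqF //.
    by rewrite mulr0 addr0.
  have [h1 h2] := mul_power_series_lowest monoW V_ideal V0 Z0; split=> //.
  by move: h2; rewrite Z coef_monoM sub0r.
have e0 n : n != 0 -> e n = 0.
  move=> n0; have [h1 h2] := component n; case: (ltP n 0) => [nlt|nge].
    have := h1 n nlt; rewrite coef_monoM subrr W0 mulr1 => h.
    by rewrite -[e n]mul1r -ca mulrAC h mul0r.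
  apply: idempotent_nilpotent; first by rewrite loc_const_mul // eqxx.
  rewrite -[e n]mulr1 -cd mulrA -h2 mulrC [_ * W _]mulrC mulrCA.
  by apply/nilpotentMl/W_nil; rewrite oppr_eq0.
have eE : e = trivial_val.
  apply/funext => n; rewrite /trivial_val; case: eqP => [->|/eqP]; last exact: e0.
  case: he => _ _ <-; apply/esym/fsbig_only1 => // k _ /eqP; exact: e0.
have [h1 h2] := component 0.
have e01 : e 0 = 1 by rewrite eE /trivial_val eqxx.
have a0 : a 0 = 1 + p * x 0 by move: h2; rewrite e01 oppr0 W0 !mulr1 mul1r.
have W1 : W = 1.
  apply: laurent_eq => k; rewrite coef_one; case: (ltgtP k 0) => [k0|/W_gt0 //|-> //].
  have := h1 k k0; rewrite coef_monoM subr0 e01 mulr1 => h.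
  by rewrite -[W k]mul1r -ca mulrAC h mul0r.
have V1 : V = 1.
  have T1 : lc_pow_t e = 1.
    by apply: laurent_eq => k; rewrite coef_lc_pow_t // eE.
  have aV : a 0 *: V = a 0 *: (1 : laurent A).
    move: WTV; rewrite W1 T1 mul1r -scaleAl mul1r => ->.
    apply: laurent_eq => k; rewrite coef_infinitesimal /= a0.
    by case: ifP; rewrite ?mulr0 ?addr0 ?mulr1.
  by rewrite -[V]scale1r -ca mulrC -scalerA aV scalerA mulrC ca scale1r.
have FmE : Fm = 1 + p *: xm.
  have := congr1 (fun f => (1 + p *: xm) * f) W1.
  by rewrite /W mulrA infinitesimalM subrr scaler0 addr0 mul1r mulr1.
have FpE : Fp = 1 + p *: xp.
  have := congr1 (fun f => f * (1 + p *: xp)) V1.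
  by rewrite /V -mulrA infinitesimalM addNr scaler0 addr0 mul1r mulr1.
split=> //; apply/funext => n; rewrite /infinitesimal_coord; case: eqP => [-> //|/eqP n0].
case: (ltgtP n 0) n0 => // nlt _.
  have -> : n = - `|n|%N%:Z by lia.
  apply: (euler_inj s2 (a := fun i => a (- i%:Z)) (b := fun i => - (p * x (- i%:Z)))).
    move=> k k0; rewrite [RHS]coef_euler_infinitesimal // ltnSn.
    rewrite -(coef_euler_stable s2 _ (leq_maxr M k.+1)) -hM ?leq_maxl //.
    rewrite (hM _ (leqnn M)) -/Fm FmE mulN1r coef_infinitesimal coef_neg_part.
    rewrite oppr_eq0 oppr_lt0 ltz_nat k0.
    by case: eqP => [?|_]; [lia|rewrite add0r].
  by lia.
have -> : n = `|n|%N%:Z by lia.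
apply: (euler_inj (mulr1 1) (a := fun i => a i%:Z) (b := fun i => - (p * x i%:Z))).
  move=> k k0; rewrite [RHS]coef_euler_infinitesimal // ltnSn mul1r.
  have -> : euler (fun i : nat => a i%:Z) 1 k.+1 k%:Z = Fp k%:Z by [].
  rewrite FpE coef_infinitesimal coef_pos_part ltz_nat k0.
  by case: eqP => [?|_]; [lia|rewrite add0r].
by lia.
Qed.

End Infinitesimal.
End Decomposition.

(** * The symbol of infinitesimal deformations and the Bott-Thurston cocycle *)

Section Symbol.
Variable A : comPzRingType.
Variables p q : A.
Hypotheses (p2 : p * p = 0) (q2 : q * q = 0).
Implicit Types (x y : laurent A).

Lemma lc_pow_trivial (u : A) : lc_pow u (@trivial_val A) = 1.
Proof.
rewrite /lc_pow (@fsbig_only1 _ _ _ _ _ _ 0) //= /trivial_val ?eqxx ?mul1r //.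
by move=> n _ /eqP/negbTE ->; rewrite mul0r.
Qed.

Lemma lc_mul_trivial : lc_mul (@trivial_val A) (@trivial_val A) = @trivial_val A.
Proof.
apply/funext => k; rewrite /lc_mul /trivial_val; case: eqP => [->|/eqP k0].
  rewrite (@fsbig_only1 _ _ _ _ _ _ (0, 0)) /= ?eqxx ?mul1r // => -[m n] /= _ mn.
  case: eqP => [m0|]; rewrite ?mul0r //; case: eqP => [n0|]; rewrite ?mulr0 //.
  by case: mn; rewrite m0 n0.
rewrite fsbig1 // => -[m n] /= mn; case: eqP => [m0|]; rewrite ?mul0r //.
by move: k0; rewrite -mn m0 mul0r eqxx.
Qed.

Lemma exprn_sqr0 (u : A) (n : nat) : u * u = 0 -> (1 < n)%N -> u ^+ n = 0.
Proof. by move=> uu; case: n => [|[|n]] // _; rewrite !exprS mulrA uu mul0r. Qed.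

Lemma expr_1B_sqr0 (u : A) n : u * u = 0 -> (1 - u) ^+ n = 1 - u *+ n.
Proof.
move=> uu; elim: n => [|n IHn]; first by rewrite mulr0n subr0.
rewrite exprS IHn mulrBl mul1r mulrBr mulr1 mulrnAr uu mul0rn subr0.
by rewrite mulrS opprD addrA addrAC.
Qed.

(** For i <> j one of i/(i,j) and j/(i,j) is at least 2, and the corresponding
    power of - p x_i or of - q y_j vanishes.  The factor with i = j is
    (1 - p q x_i y_i)^i. *)
Lemma CC_product_infinitesimal (a b x y : nat -> A) (N : nat) :
  (forall i, (0 < i)%N -> a i = - (p * x i)) ->
  (forall i, (0 < i)%N -> b i = - (q * y i)) ->
  (forall i, (N <= i)%N -> p * q * (x i * y i) = 0) ->
  CC_product a b = 1 - p * q * \sum_(i < N) (x i * y i) *+ i.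
Proof.
move=> ha hb hN; rewrite /CC_product.
have ab i : (0 < i)%N -> a i * b i = p * q * (x i * y i).
  by move=> i0; rewrite ha // hb //; ring.
pose r := [seq (i, i) | i <- index_iota 1 N].
have ur : uniq r by rewrite map_inj_uniq ?iota_uniq // => u v [].
transitivity (\prod_(c <- r) (1 - a c.1 ^+ (c.2 %/ gcdn c.1 c.2)
    * b c.2 ^+ (c.1 %/ gcdn c.1 c.2)) ^+ gcdn c.1 c.2).
  rewrite (fsbig_seq _ _ ur); apply/esym/fsbig_widen.
    by move=> _ /= /mapP[i + ->]; rewrite mem_index_iota => /andP[].
  move=> [i j] /= [[i0 j0] ijr].
  have [ij|ij] := eqVneq i j.
    rewrite -ij gcdnn divnn i0 !expr1 ab // hN ?subr0 ?expr1n //.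
    rewrite leqNgt; apply/negP => iN; apply: ijr; apply/mapP; exists i; rewrite ?ij //.
    by rewrite mem_index_iota -ij i0.
  have g0 : (0 < gcdn i j)%N by rewrite gcdn_gt0 i0.
  have aE := divnK (dvdn_gcdl i j); have bE := divnK (dvdn_gcdr i j).
  have ag : (0 < i %/ gcdn i j)%N by rewrite divn_gt0 // dvdn_leq // dvdn_gcdl.
  have bg : (0 < j %/ gcdn i j)%N by rewrite divn_gt0 // dvdn_leq // dvdn_gcdr.
  have [h|h] : (1 < i %/ gcdn i j)%N \/ (1 < j %/ gcdn i j)%N.
  - case: (ltnP 1 (i %/ gcdn i j)) => hi; first by left.
    case: (ltnP 1 (j %/ gcdn i j)) => hj; first by right.
    have i1 : (i %/ gcdn i j = 1)%N by lia.
    have j1 : (j %/ gcdn i j = 1)%N by lia.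
    by move: ij; rewrite -aE -[in X in _ != X]bE i1 j1 eqxx.
  - by rewrite [b j ^+ _]exprn_sqr0 ?mulr0 ?subr0 ?expr1n // hb // mulrNN mulrACA q2 mul0r.
  by rewrite [a i ^+ _]exprn_sqr0 ?mul0r ?subr0 ?expr1n // ha // mulrNN mulrACA p2 mul0r.
rewrite big_map.
transitivity (\prod_(1 <= i < N) (1 - p * q * (x i * y i *+ i))).
  apply: eq_big_nat => i /andP[i0 _] /=.
  rewrite gcdnn divnn i0 !expr1 ab // expr_1B_sqr0 ?mulrnAr //.
  by rewrite mulrACA [p * q * _]mulrACA p2 !mul0r.
transitivity (1 - p * q * \sum_(1 <= i < N) x i * y i *+ i).
  apply: (big_rec2 (fun u v => u = 1 - p * q * v)); first by rewrite mulr0 subr0.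
  move=> i u v _ ->; set w := x i * y i *+ i.
  by ring: p2.
congr (1 - _ * _); case: N {hN r ur} => [|N]; first by rewrite big_ord0 big_geq.
by rewrite -(big_mkord xpredT (fun i => x i * y i *+ i)) [RHS]big_ltn // mulr0n add0r.
Qed.

Lemma CC_infinitesimal x y (N : nat) :
  (forall i : nat, (N <= i)%N -> p * q * x (- i%:Z) = 0) ->
  (forall i : nat, (N <= i)%N -> p * q * y (- i%:Z) = 0) ->
  CC (1 + p *: x) (1 + q *: y) = 1 + p * q *
    (\sum_(i < N) (x (- i%:Z) * y i%:Z) *+ i - \sum_(i < N) (x i%:Z * y (- i%:Z)) *+ i).
Proof.
move=> xN yN; rewrite /CC; set P := [set c | _].
have [e [a [e' [b [hx hy ->]]]]] : P (xget 1 P).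
  apply: xgetPex; exists (CC_value (@trivial_val A) (infinitesimal_coord p x)
    (@trivial_val A) (infinitesimal_coord q y)).
  exists (@trivial_val A), (infinitesimal_coord p x), (@trivial_val A), (infinitesimal_coord q y).
  by split=> //; apply: infinitesimal_decomposition.
have [-> ->] := CC_decomposition_infinitesimal p2 hx.
have [-> ->] := CC_decomposition_infinitesimal q2 hy.
rewrite /CC_value lc_mul_trivial !lc_pow_trivial !mul1r.
rewrite (@CC_product_infinitesimal _ _ (fun i => x i%:Z) (fun i => y (- i%:Z)) N); first last.
- by move=> i iN; rewrite mulrCA yN ?mulr0.
- by case.
- by case.
rewrite (@CC_product_infinitesimal _ _ (fun i => x (- i%:Z)) (fun i => y i%:Z) N); first last.
- by move=> i iN; rewrite mulrA xN ?mul0r.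
- by case.
- by case.
set S1 := \sum_(i < N) _; set S2 := \sum_(i < N) _.
rewrite (@rinvE _ _ (1 + p * q * S2)); last by ring: p2.
by ring: p2.
Qed.

(** The second argument of the symbol is 1 + q (y' + p x y''); the term with p
    disappears since the first argument is 1 + p x'. *)
Lemma cocycle_B_shift x y N :
  ideal_t A (2 - N%:Z) x -> ideal_t A (2 - N%:Z) y ->
  cocycle_B (infinitesimal_shift p x) (infinitesimal_shift q y)
  = 1 + p * q * ((virasoro_sum N x y - virasoro_sum N y x) *+ 6).
Proof.
move=> hx hy; rewrite /cocycle_B /tilde.
have shift_t c z : infinitesimal_shift c z (var_t A) = var_t A + c *: z.
  by rewrite /infinitesimal_shift deriv_mono mulr1z subrr mulr1.
have dt c z : deriv (infinitesimal_shift c z (var_t A)) = 1 + c *: deriv z.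
  by rewrite shift_t derivD derivZ deriv_mono mulr1z subrr.
rewrite laurent_comp_shift // !dt shiftD shiftZ.
have -> : infinitesimal_shift p x 1 = 1.
  rewrite /infinitesimal_shift.
  have -> : deriv 1 = 0 :> laurent A by rewrite deriv_mono mulr0z mono0.
  by rewrite mulr0 scaler0 addr0.
have hd z : ideal_t A (2 - N%:Z) z -> forall i : nat, (N <= i)%N -> deriv z (- i%:Z) = 0.
  by move=> hz i iN; apply: (ideal_deriv hz); lia.
have pqy k : p * q * infinitesimal_shift p x (deriv y) k = p * q * deriv y k.
  rewrite -[infinitesimal_shift _ _ _ k]/(deriv y k + p * (x * deriv (deriv y)) k).
  by ring: p2.
rewrite (@CC_infinitesimal _ _ N); first last.
- by move=> i iN; rewrite pqy hd ?mulr0.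
- by move=> i iN; rewrite hd ?mulr0.
congr (1 + _); rewrite mulrBr mulrnBl mulrBr addrC -[in RHS]mulrN.
rewrite /virasoro_sum -!sumrMnl -!sumrN !mulr_sumr.
have coefficient (i : nat) (u v : A) :
    (u *~ (- i%:Z + 1)) * (v *~ (i%:Z + 1)) *+ i = - (v * u *+ 'C(i.+1, 3) *+ 6).
  rewrite mulrzAl mulrzAr -!mulrzA pmulrn -!mulrzA [u * v]mulrC.
  rewrite -mulrnA [in RHS]pmulrn -mulrNz; congr (_ *~ _).
  have -> : ('C(i.+1, 3) * 6 = i.+1 * (i * i.-1))%N.
    by rewrite -[6%N]/(3`!)%N bin_ffact !ffactnSr ffactn0; lia.
  by case: i => [|i]; lia.
have drop_p u k (i : nat) : p * q * (u * infinitesimal_shift p x (deriv y) k *+ i)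
    = p * q * (u * deriv y k *+ i).
  by rewrite -!mulrnAl ![p * q * (_ * _)]mulrCA pqy.
rewrite -sumrN; congr (_ + _); apply: eq_bigr => i _; rewrite drop_p /=.
  rewrite [x _ *~ _ * _]mulrC coefficient mulrN opprK.
  by congr (_ * (coef x _ * coef y _ *+ _ *+ _)); lia.
by rewrite coefficient; congr (_ * - (coef y _ * coef x _ *+ _ *+ _)); lia.
Qed.
End Symbol.

(** * The two Lie cocycles *)

(** The partial sums are constant from N = 2 on; the bound 2 - n only serves the
    two earlier ones. *)
Lemma laurent_comp_var (A : comPzRingType) (f : laurent A) : laurent_comp (var_t A) f = f.
Proof.
rewrite /laurent_comp fsbig1 ?add0r; last first.
  by move=> i /= i0; case: eqP i0 => [->//|_ _]; rewrite scale0r.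
have [n hn] := coef_bound f.
apply: (@lim_laurent _ _ _ (2 - n)) => N.
case: N => [|[|N]].
- by rewrite big_ord0 subr0; apply: ideal_le hn; lia.
- rewrite big_ord_recr big_ord0 /= scale0r addr0 subr0; apply: ideal_le hn; lia.
rewrite !big_ord_recl big1 /= => [|i _]; last by rewrite scale0r.
by rewrite scale0r add0r expr1 scale1r addr0 subrr => k _ /=; rewrite if_same.
Qed.

(** Triviality at eps = 0, read off at the series t. *)
Lemma Lie_G_tilde (A : comPzRingType) h : @Lie_G A h ->
  exists g : laurent A, tilde h = var_t _ + eps A *: map_laurent (@dn_const A) g.
Proof.
case=> _ /(congr1 (fun F => F (var_t A))); rewrite /G_map laurent_comp_var => hre.
have [n hn] := coef_bound (tilde h).
have gb : exists m : int, forall i, i < m -> dn_im (tilde h i) = 0.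
  by exists n => i /hn ->.
exists (Laurent gb); apply: laurent_eq => k.
have := congr1 (fun f => coef f k) hre => /=.
case: (tilde h k) => a b /= ->.
by case: (k == 1); congr Dnum; rewrite /= ?mul0r ?mul1r ?addr0 ?add0r.
Qed.

Section Lie.
Variable A : comPzRingType.
Local Notation B := (dnum (dnum A)).

Definition dn_const2 : {rmorphism A -> B} := (@dn_const (dnum A) \o @dn_const A)%FUN.

Lemma eps1_sqr0 : eps1 A * eps1 A = 0.
Proof.
by congr (Dnum (Dnum _ _) (Dnum _ _)); rewrite /= ?(mul0r, mulr0, mul1r, mulr1, addr0).
Qed.

Lemma eps2_sqr0 : eps2 A * eps2 A = 0.
Proof.
by congr (Dnum (Dnum _ _) (Dnum _ _)); rewrite /= ?(mul0r, mulr0, mul1r, mulr1, addr0).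
Qed.

Lemma eps12_inj (c d : A) :
  1 + dn_const2 c * eps1 A * eps2 A = 1 + dn_const2 d * eps1 A * eps2 A -> c = d.
Proof.
by move/addrI => []; rewrite /= ?(mul0r, mulr0, mul1r, mulr1, addr0, add0r).
Qed.

Lemma G_map_shift (incl : {rmorphism dnum A -> B}) e h g :
  e * e = 0 -> incl (eps A) = e -> (forall c, incl (dn_const c) = dn_const2 c) ->
  tilde h = var_t _ + eps A *: map_laurent (@dn_const A) g ->
  G_map incl h = infinitesimal_shift e (map_laurent dn_const2 g).
Proof.
move=> e2 incl_eps incl_const hg; apply/funext => f.
rewrite /G_map -(laurent_comp_shift _ e2); congr laurent_comp.
rewrite hg /infinitesimal_shift deriv_mono mulr1z subrr mulr1.
apply: laurent_eq => k.
rewrite [LHS]/= rmorphD rmorphM incl_eps incl_const /=.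
by case: (k == 1); rewrite ?rmorph1 ?rmorph0.
Qed.

Lemma incl2_const (c : A) : incl2 A (dn_const c) = dn_const2 c.
Proof. by []. Qed.

Lemma dn_const2_virasoro_sum N (x y : laurent A) :
  virasoro_sum N (map_laurent dn_const2 x) (map_laurent dn_const2 y)
  = dn_const2 (virasoro_sum N x y).
Proof.
by rewrite /virasoro_sum rmorph_sum; apply: eq_bigr => i _; rewrite rmorphMn rmorphM.
Qed.

(** The quotient of 1 + eps1 eps2 c by 1 + eps1 eps2 d is 1 + eps1 eps2 (c - d). *)
Lemma Lie_cocycleE
    (Lambda : forall R : comPzRingType,
       (laurent R -> laurent R) -> (laurent R -> laurent R) -> R)
    (h1 h2 : laurent (dnum A) -> laurent (dnum A)) (c d : A) :
  Lambda _ (G_map (incl1 A) h1) (G_map (incl2 A) h2) = 1 + eps1 A * eps2 A * dn_const2 c ->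
  Lambda _ (G_map (incl2 A) h2) (G_map (incl1 A) h1) = 1 + eps1 A * eps2 A * dn_const2 d ->
  Lie_cocycle Lambda h1 h2 = c - d.
Proof.
move=> h12 h21; have e1 := eps1_sqr0; have e2 := eps2_sqr0.
rewrite /Lie_cocycle h12 h21 (@rinvE _ _ (1 - eps1 A * eps2 A * dn_const2 d)); last by ring: e1.
have val : (1 + eps1 A * eps2 A * dn_const2 c) * (1 - eps1 A * eps2 A * dn_const2 d)
    = 1 + dn_const2 (c - d) * eps1 A * eps2 A.
  by rewrite rmorphB; ring: e1.
rewrite val; apply: xget_unique => // b; rewrite -/(dn_const2 b) => hb.
exact/esym/eps12_inj.
Qed.
End Lie.

Theorem theorem4p1 (A : comPzRingType)
    (s r : laurent (dnum A) -> laurent (dnum A))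
    (hs : Lie_G A s) (hr : Lie_G A r) :
  (Lie_D s r) *+ 12 = Lie_B s r.
Proof.
have e1 := eps1_sqr0 A; have e2 := eps2_sqr0 A.
have [x /(@G_map_shift _ (incl1 A) _ _ _ e1 erefl (fun=> erefl)) Hs] := Lie_G_tilde hs.
have [y /(@G_map_shift _ (incl2 A) _ _ _ e2 erefl (@incl2_const A)) Hr] := Lie_G_tilde hr.
have [a ha] := laurent_bound x; have [b hb] := laurent_bound y.
pose N := (a + b).+2.
have hx : ideal_t _ (2 - N%:Z) (map_laurent (@dn_const2 A) x).
  by move=> i iN; rewrite /= ha; [|lia].
have hy : ideal_t _ (2 - N%:Z) (map_laurent (@dn_const2 A) y).
  by move=> i iN; rewrite /= hb; [|lia].
have -> : Lie_D s r = virasoro_sum N x y - virasoro_sum N y x.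
  apply: (@Lie_cocycleE _ (@cocycle_D)); rewrite Hs Hr -dn_const2_virasoro_sum.
    exact: cocycle_D_shift.
  by rewrite (cocycle_D_shift _ e2 e1 hx) [eps2 A * _]mulrC.
pose c := (virasoro_sum N x y - virasoro_sum N y x) *+ 6.
have -> : Lie_B s r = c - (- c).
  apply: (@Lie_cocycleE _ (@cocycle_B)); rewrite Hs Hr.
    by rewrite (cocycle_B_shift e1 e2 hx hy) !dn_const2_virasoro_sum -rmorphB -rmorphMn.
  rewrite (cocycle_B_shift e2 e1 hy hx) !dn_const2_virasoro_sum -rmorphB -rmorphMn.
  by rewrite [eps2 A * _]mulrC /c -mulNrn opprB.
by rewrite opprK /c -mulrnDr.
Qed.
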